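(* Let $f:\mathbb{R}^n\to\mathbb{R}$ be of class $C^{2+}$ with $L_f$-Lipschitz continuous gradient, let $g:\mathbb{R}^n\to\mathbb{R}\cup\{+\infty\}$ be proper, lower semicontinuous and $\rho$-weakly convex, let $\varphi=f+g$ with $\operatorname{argmin}\varphi\neq\emptyset$, and suppose $\{x:\varphi(x)\le\varphi(x^0)\}$ is bounded. Suppose the iterates $(x^k)$ generated by the NTRA algorithm described in the context converge to a critical point $x^\star$, that $f$ is of class $C^3$ locally around $x^\star$ and $\operatorname{prox}_{\gamma g}$ is of class $C^1$ locally around $x^\star-\gamma\nabla f(x^\star)$ (with $\gamma$ the stepsize of the algorithm, assumed sufficiently small), and that there is $\beta_2>0$ such that for every $k$ with $B_k$ indefinite, $m_k(0)-m_k(d^k)\ge\beta_2(-\lambda_{\min}(B_k))\delta_k^2$. Then $x^\star$ is a second-order stationary point of $\varphi$.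
   Context: $C^{2+}$: twice continuously differentiable with locally Lipschitz Hessian; $g$ is $\rho$-weakly convex if $g+\frac\rho2\|\cdot\|^2$ is convex. $\operatorname{prox}_{\gamma g}(x)=\operatorname{argmin}_z\{g(z)+\frac1{2\gamma}\|z-x\|^2\}$, $T_\gamma(x)=\operatorname{prox}_{\gamma g}(x-\gamma\nabla f(x))$, $R_\gamma(x)=\gamma^{-1}(x-T_\gamma(x))$; $x^\star$ is critical if $x^\star\in T_\gamma(x^\star)$. Forward-backward envelope $\varphi_\gamma(x)=\inf_u\{f(x)+\langle\nabla f(x),u-x\rangle+g(u)+\frac1{2\gamma}\|u-x\|^2\}$. $\partial_C$: Clarke generalized Jacobian. A point $x^\star$ is a second-order stationary point of $\varphi$ if $0\in\partial\varphi(x^\star)$ (limiting subdifferential) and $\mathrm d^2\varphi(x^\star,0)(d)\ge0$ for all $d$, with $\mathrm d^2$ the second subderivative (Rockafellar–Wets Def. 13.3). NTRA: given $x^0$, $\gamma\in(0,\min\{1/L_f,1/\rho\})$, $\delta_0>0$, $0<\mu_1<\mu_2<1$, $0<c_1<c_2<1<c_3$; for $k=0,1,\dots$: select $P_k\in\partial_C\operatorname{prox}_{\gamma g}(x^k-\gamma\nabla f(x^k))$; $Q_k=I-\gamma\nabla^2f(x^k)$, $B_k=\gamma^{-1}Q_k(I-P_kQ_k)$; stop if $R_\gamma(x^k)=0$ and $\lambda_{\min}(B_k)\ge0$; $d^k$ is an (approximate) solution of $\min_d m_k(d):=\varphi_\gamma(x^k)+\langle\nabla\varphi_\gamma(x^k),d\rangle+\frac12\langle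 B_kd,d\rangle$ s.t. $\|d\|\le\delta_k$; $\rho_k=\frac{\varphi_\gamma(x^k)-\varphi_\gamma(x^k+d^k)}{m_k(0)-m_k(d^k)}$; $x^{k+1}=x^k$ if $\rho_k<\mu_1$, else $x^k+d^k$; $\delta_{k+1}=c_1\delta_k$ if $\rho_k<\mu_1$, $c_2\delta_k$ if $\mu_1\le\rho_k<\mu_2$, $c_3\delta_k$ if $\rho_k\ge\mu_2$. *)

(* Defs.v *)
From HB Require Import structures.
From mathcomp Require Import all_boot all_order all_algebra.
From mathcomp Require Import all_classical all_reals all_analysis.
Set Implicit Arguments. Unset Strict Implicit. Unset Printing Implicit Defensive.
Import Order.TTheory GRing.Theory Num.Theory.
Import numFieldNormedType.Exports.
Local Open Scope classical_set_scope.
Local Open Scope ring_scope.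

Section Defs.
Variables (R : realType) (n : nat).
Local Notation vec := 'cV[R]_n.
Local Notation mat := 'M[R]_n.

Definition dotv (u v : vec) : R := \sum_(i < n) u i 0 * v i 0.
Definition enorm (u : vec) : R := Num.sqrt (dotv u u).
Definition eball (x : vec) (r : R) : set vec := [set y | enorm (y - x) < r].

Definition jacobian (F : vec -> vec) (x : vec) : mat :=
  \matrix_(i < n, j < n) ('d F x (delta_mx j 0 : vec)) i 0.

Definition bjac (F : vec -> vec) (y : vec) : set mat :=
  [set M | exists u : nat -> vec, (u @ \oo --> y) /\
      (forall k, differentiable F (u k)) /\
      ((fun k => jacobian F (u k)) @ \oo --> M)].

Definition clarke_jac (F : vec -> vec) (y : vec) : set mat :=
  [set M | exists (m : nat) (w : 'I_m -> R) (A : 'I_m -> mat),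
      (forall i, 0 <= w i) /\ \sum_(i < m) w i = 1 /\
      (forall i, bjac F y (A i)) /\ M = \sum_(i < m) w i *: A i].

Definition lam_min (B : mat) : R := inf [set a : R | eigenvalue B a].

Definition proper_fun (g : vec -> \bar R) : Prop :=
  (forall x, g x != -oo%E) /\ (exists x, g x \is a fin_num).
Definition lsc (g : vec -> \bar R) : Prop :=
  forall x (a : R), (a%:E < g x)%E -> \forall y \near x, (a%:E < g y)%E.
Definition weakly_convex (rho : R) (g : vec -> \bar R) : Prop :=
  forall (x y : vec) (t : R), 0 <= t <= 1 ->
    (g ((1 - t) *: x + t *: y)%R + (rho / 2 * enorm ((1 - t) *: x + t *: y)%R ^+ 2)%:E
     <= ((1 - t)%:E * (g x + (rho / 2 * enorm x ^+ 2)%:E)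
        + t%:E * (g y + (rho / 2 * enorm y ^+ 2)%:E)))%E.

Definition is_argmin (h : vec -> \bar R) (p : vec) : Prop := forall z, (h p <= h z)%E.

Definition is_prox (g : vec -> \bar R) (gam : R) (x p : vec) : Prop :=
  is_argmin (fun z => g z + (enorm (z - x) ^+ 2 / (2 * gam))%:E)%E p.

Definition fbe (f : vec -> R) (gradf : vec -> vec) (g : vec -> \bar R) (gam : R)
    (x : vec) : \bar R :=
  ereal_inf [set ((f x + dotv (gradf x) (u - x))%:E + g u
                  + (enorm (u - x) ^+ 2 / (2 * gam))%:E)%E | u in [set: vec]].

Definition reg_subgrad (phi : vec -> \bar R) (x v : vec) : Prop :=
  phi x \is a fin_num /\
  forall eps : R, 0 < eps -> \forall y \near x,
    (phi x + (dotv v (y - x) - eps * enorm (y - x))%:E <= phi y)%E.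

(* limiting subdifferential (Rockafellar--Wets Def. 8.3) *)
Definition lim_subdiff (phi : vec -> \bar R) (x : vec) : set vec :=
  [set v | phi x \is a fin_num /\
    exists (xs vs : nat -> vec), (xs @ \oo --> x) /\ (vs @ \oo --> v) /\
      ((fun k => phi (xs k)) @ \oo --> phi x) /\ (forall k, reg_subgrad phi (xs k) (vs k))].

(* second-order difference quotient and second subderivative (RW Def. 13.3) *)
Definition dq2 (phi : vec -> \bar R) (x v : vec) (t : R) (w : vec) : \bar R :=
  ((phi (x + t *: w)%R - phi x - (t * dotv v w)%:E) * (2 / t ^+ 2)%:E)%E.
Definition subderiv2 (phi : vec -> \bar R) (x v w : vec) : \bar R :=
  ereal_sup [set ereal_inf [set z | exists (t : R) (w' : vec),
                                   [/\ 0 < t < e, eball w e w' & z = dq2 phi x v t w']]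
            | e in [set e : R | 0 < e]].

Definition second_order_stationary (phi : vec -> \bar R) (x : vec) : Prop :=
  lim_subdiff phi x 0 /\ forall d : vec, (0 <= subderiv2 phi x 0 d)%E.

Definition fplusg (f : vec -> R) (g : vec -> \bar R) (x : vec) : \bar R := ((f x)%:E + g x)%E.

Definition Tmap (gradf : vec -> vec) (prox : vec -> vec) (gam : R) (x : vec) : vec :=
  prox (x - gam *: gradf x).
Definition Rres (gradf : vec -> vec) (prox : vec -> vec) (gam : R) (x : vec) : vec :=
  gam^-1 *: (x - Tmap gradf prox gam x).
Definition Qmat (hessf : vec -> mat) (gam : R) (x : vec) : mat := 1%:M - gam *: hessf x.
Definition Bmat (hessf : vec -> mat) (gam : R) (x : vec) (P : mat) : mat :=
  gam^-1 *: (Qmat hessf gam x *m (1%:M - P *m Qmat hessf gam x)).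
Definition fbeR (f : vec -> R) (gradf : vec -> vec) (g : vec -> \bar R) (gam : R)
  (x : vec) : R := fine (fbe f gradf g gam x).
Definition tr_model (f : vec -> R) (gradf : vec -> vec) (g : vec -> \bar R) (gam : R)
  (x : vec) (B : mat) (d : vec) : R :=
  fbeR f gradf g gam x + 'd (fbeR f gradf g gam) x d + 2^-1 * dotv (B *m d) d.

End Defs.

(* Main.v *)
(* Write B for the matrix B_k at the limit point xs, with P the Jacobian of the proximal map.
   Suppose B had a direction of negative curvature.  For large k the P_k are Jacobians of the
   C^1 proximal map, so B_k tends to B, lambda_min(B_k) stays below some -eps, and the predicted
   decrease is at least beta2 eps delta_k^2.  The gradient Q R of the forward-backward envelope
   is strictly differentiable at xs with derivative B, because R vanishes at xs; hence the model
   error is o(|d|^2) uniformly near xs, and every step with a small radius is very successful.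
   The radius therefore cannot tend to 0, whereas convergence of the envelope values forces all
   late steps to be rejected: a contradiction.  So B is positive semidefinite, and the
   second-order expansion of the envelope, a minorant of f + g that is exact at xs, gives the
   second-order condition.

   All estimates use the sup norm of the library, which enorm dominates. *)
Require Import Defs.
From HB Require Import structures.
From mathcomp Require Import all_boot all_order all_algebra.
From mathcomp Require Import all_classical all_reals all_analysis.
From mathcomp Require Import ring lra.
Set Implicit Arguments.
Unset Strict Implicit.
Unset Printing Implicit Defensive.
Import Order.TTheory GRing.Theory Num.Theory.
Import numFieldNormedType.Exports.
Local Open Scope classical_set_scope.
Local Open Scope ring_scope.

(** * Euclidean inner product, sup norm of matrices, and entrywise limits *)

Section Euclidean.
Variables (R : realType) (n : nat).
Implicit Types (u v w : 'cV[R]_n) (A B : 'M[R]_n).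

Lemma dotvC u v : dotv u v = dotv v u.
Proof. by apply: eq_bigr => i _; rewrite mulrC. Qed.

Lemma dotvDl u v w : dotv (u + v) w = dotv u w + dotv v w.
Proof. by rewrite -big_split; apply: eq_bigr => i _; rewrite mxE mulrDl. Qed.

Lemma dotvZl (a : R) u v : dotv (a *: u) v = a * dotv u v.
Proof. by rewrite mulr_sumr; apply: eq_bigr => i _; rewrite mxE mulrA. Qed.

Lemma dotvDr u v w : dotv w (u + v) = dotv w u + dotv w v.
Proof. by rewrite dotvC dotvDl !(dotvC w). Qed.

Lemma dotvZr (a : R) u v : dotv v (a *: u) = a * dotv v u.
Proof. by rewrite dotvC dotvZl (dotvC v). Qed.

Lemma dotvNl u v : dotv (- u) v = - dotv u v.
Proof. by rewrite -scaleN1r dotvZl mulN1r. Qed.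

Lemma dotvNr u v : dotv v (- u) = - dotv v u.
Proof. by rewrite -scaleN1r dotvZr mulN1r. Qed.

Lemma dotvBl u v w : dotv (u - v) w = dotv u w - dotv v w.
Proof. by rewrite dotvDl dotvNl. Qed.

Lemma dotvBr u v w : dotv w (u - v) = dotv w u - dotv w v.
Proof. by rewrite dotvDr dotvNr. Qed.

Lemma dotv0l v : dotv 0 v = 0.
Proof. by rewrite -(scale0r 0) dotvZl mul0r. Qed.

Lemma dotv0r v : dotv v 0 = 0.
Proof. by rewrite dotvC dotv0l. Qed.

Lemma dotv_ge0 u : 0 <= dotv u u.
Proof. by apply: sumr_ge0 => i _; rewrite -expr2 sqr_ge0. Qed.

Lemma dotv_eq0 u : dotv u u = 0 -> u = 0.
Proof.
move/eqP; rewrite psumr_eq0 => [/allP u0|i _]; last by rewrite -expr2 sqr_ge0.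
apply/colP => i; rewrite mxE; apply/eqP.
by have := u0 i (mem_index_enum i); rewrite mulf_eq0 orbb.
Qed.

Lemma dotv_gt0 u : u != 0 -> 0 < dotv u u.
Proof.
move=> u0; rewrite lt_neqAle dotv_ge0 andbT.
by apply: contra u0 => /eqP /esym /dotv_eq0 ->.
Qed.

Lemma dotv_mulmx A u v : dotv (A *m u) v = dotv u (A^T *m v).
Proof.
rewrite /dotv (eq_bigr (fun i => \sum_j A i j * u j 0 * v i 0)); last first.
  by move=> i _; rewrite mxE mulr_suml.
rewrite exchange_big; apply: eq_bigr => j _ /=.
by rewrite mxE mulr_sumr; apply: eq_bigr => i _; rewrite mxE; ring.
Qed.

Lemma enorm_sqr u : enorm u ^+ 2 = dotv u u.
Proof. by rewrite sqr_sqrtr ?dotv_ge0. Qed.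

Lemma mx_norm_entry m p (A : 'M[R]_(m, p)) i j : `|A i j| <= `|A|.
Proof.
by rewrite [leRHS]/Num.Def.normr /= mx_normrE; apply/bigmax_geP; right; exists (i, j).
Qed.

Lemma mx_norm_le m p (A : 'M[R]_(m, p)) (c : R) : 0 <= c ->
  (forall i j, `|A i j| <= c) -> `|A| <= c.
Proof.
by move=> c0 Ac; rewrite [leLHS]/Num.Def.normr /= mx_normrE; apply/bigmax_leP; split.
Qed.

Lemma cvg_mx (T : Type) (F : set_system T) m p (M : T -> 'M[R]_(m, p))
    (L : 'M[R]_(m, p)) :
  Filter F -> (forall i j, (fun t => M t i j) @ F --> L i j) -> M @ F --> L.
Proof.
move=> FF ML; apply/cvgrPdist_le => e e0.
have : \forall t \near F, forall ij : 'I_m * 'I_p, `|L ij.1 ij.2 - M t ij.1 ij.2| <= e.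
  by apply: filter_forall => ij; move: e e0; apply/cvgrPdist_le/ML.
apply: filterS => t tM; apply: mx_norm_le; first exact: ltW.
by move=> i j; rewrite !mxE; exact: (tM (i, j)).
Qed.

Lemma cvg_mx_entry (T : Type) (F : set_system T) m p (M : T -> 'M[R]_(m, p))
    (L : 'M[R]_(m, p)) i j : Filter F -> M @ F --> L -> (fun t => M t i j) @ F --> L i j.
Proof. by move=> FF ML; exact: (cvg_comp _ _ ML (@coord_continuous _ _ _ i j L)). Qed.

Lemma cvg_mulmx (T : Type) (F : set_system T) m p q (A : T -> 'M[R]_(m, p))
    (B : T -> 'M[R]_(p, q)) (A0 : 'M[R]_(m, p)) (B0 : 'M[R]_(p, q)) : Filter F ->
  A @ F --> A0 -> B @ F --> B0 -> (fun t => A t *m B t) @ F --> A0 *m B0.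
Proof.
move=> FF AF BF; apply: cvg_mx => i j; rewrite mxE; under eq_fun do rewrite mxE.
by apply: cvg_big => [|k _]; [exact: add_continuous | apply: cvgM; exact: cvg_mx_entry].
Qed.

Lemma cvg_trmx (T : Type) (F : set_system T) m p (A : T -> 'M[R]_(m, p))
    (A0 : 'M[R]_(m, p)) : Filter F -> A @ F --> A0 -> (fun t => (A t)^T) @ F --> A0^T.
Proof.
move=> FF AF; apply: cvg_mx => i j; rewrite mxE; under eq_fun do rewrite mxE.
exact: cvg_mx_entry.
Qed.

Lemma cvg_dotv (T : Type) (F : set_system T) (u v : T -> 'cV[R]_n) (u0 v0 : 'cV[R]_n) :
  Filter F -> u @ F --> u0 -> v @ F --> v0 ->
  (fun t => dotv (u t) (v t)) @ F --> dotv u0 v0.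
Proof.
move=> FF uF vF; apply: cvg_big => [|k _]; first exact: add_continuous.
by apply: cvgM; exact: cvg_mx_entry.
Qed.

Lemma dotv_norm u v : `|dotv u v| <= n%:R * `|u| * `|v|.
Proof.
apply: le_trans (ler_norm_sum _ _ _) _.
apply: (@le_trans _ _ (\sum_(i < n) `|u| * `|v|)).
  by apply: ler_sum => i _; rewrite normrM ler_pM ?mx_norm_entry.
by rewrite sumr_const card_ord -mulrA mulr_natl.
Qed.

Lemma mulmx_norm A u : `|A *m u| <= n%:R * `|A| * `|u|.
Proof.
apply: mx_norm_le => [|i j]; first by rewrite !mulr_ge0.
rewrite mxE; apply: le_trans (ler_norm_sum _ _ _) _.
apply: (@le_trans _ _ (\sum_(i < n) `|A| * `|u|)).
  by apply: ler_sum => k _; rewrite normrM ler_pM ?mx_norm_entry.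
by rewrite sumr_const card_ord -mulrA mulr_natl.
Qed.

Lemma norm_le_enorm u : `|u| <= enorm u.
Proof.
apply: mx_norm_le => [|i j]; first exact: sqrtr_ge0.
rewrite ord1 -sqrtr_sqr ler_wsqrtr // expr2 /dotv (bigD1 i) //= lerDl.
by apply: sumr_ge0 => k _; rewrite -expr2 sqr_ge0.
Qed.

Lemma enorm_le_norm u : enorm u <= n%:R * `|u|.
Proof.
rewrite -[leRHS]ger0_norm ?mulr_ge0// -sqrtr_sqr ler_wsqrtr //.
apply: le_trans (ler_norm _) _; apply: le_trans (dotv_norm _ _) _.
rewrite exprMn -mulrA -expr2 ler_wpM2r ?sqr_ge0// -natrX ler_nat.
by case: (n) => // k; rewrite expnS leq_pmulr ?expn_gt0.
Qed.

End Euclidean.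

(** * Mean value theorem along segments and strict differentiability *)

Section Differentials.
Variables (R : realType) (n : nat).
Local Notation vec := 'cV[R]_n.
Local Notation mat := 'M[R]_n.

Lemma is_derive_line (V : normedModType R) (F : V -> R) (u h : V) (t : R) :
  differentiable F (u + t *: h) ->
  is_derive t 1 (fun s : R => F (u + s *: h)) ('d F (u + t *: h) h).
Proof.
move=> dF; set l := fun s : R => u + s *: h.
have dl : is_diff t l (fun s => s *: h).
  by rewrite -[X in is_diff _ _ X]add0r; apply: is_diffD.
have dFl : is_diff (l t) F ('d F (l t)) by exact: differentiableP.
have dc : is_diff t (F \o l) ('d F (l t) \o (fun s => s *: h)).
  exact: is_diff_comp.
apply: DeriveDef; first exact/derivable1_diffP.
by rewrite deriveE // diff_val /= scale1r.
Qed.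

Lemma mvt01 (f df : R -> R) :
  (forall t : R, 0 <= t <= 1 -> is_derive t 1 f (df t)) ->
  exists2 t : R, 0 <= t <= 1 & f 1 - f 0 = df t.
Proof.
move=> fdf; have [||t t01 ->] := @MVT_segment _ f df 0 1 ler01.
- by move=> t; rewrite in_itv /= => /andP[t0 t1]; apply: fdf; rewrite !ltW.
- apply: derivable_within_continuous => t; rewrite in_itv /= => /fdf dt.
  exact: ex_derive.
by exists t; [rewrite in_itv in t01 | rewrite subr0 mulr1].
Qed.

Lemma ball_segment (V : normedModType R) (x u h : V) (r t : R) : 0 <= t <= 1 ->
  `|u - x| < r -> `|u + h - x| < r -> `|u + t *: h - x| < r.
Proof.
move=> /andP[t0 t1] ur vr.
have -> : u + t *: h - x = (1 - t) *: (u - x) + t *: (u + h - x).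
  by rewrite (addrAC u h) (scalerDr t) addrA -scalerDl subrK scale1r addrAC.
apply: le_lt_trans (ler_normD _ _) _.
rewrite !normrZ !ger0_norm ?subr_ge0//.
have -> : r = (1 - t) * r + t * r by ring.
(* The strict inequality comes from the summand weighted by [t], so [t = 0] is treated apart. *)
move: t0; rewrite le_eqVlt => /predU1P[<-|t0].
  by rewrite !mul0r !addr0 subr0 !mul1r.
by rewrite ler_ltD// ?ltr_pM2l// ler_wpM2l ?subr_ge0// ltW.
Qed.

Lemma differentiable_line (Phi : vec -> R) (u h : vec) :
  (forall t : R, 0 <= t <= 1 -> differentiable Phi (u + t *: h)) ->
  exists2 t : R, 0 <= t <= 1 & Phi (u + h) - Phi u = 'd Phi (u + t *: h) h.
Proof.
move=> dPhi; have [t t01 e] := mvt01 (fun t t01 => is_derive_line (dPhi t t01)).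
by exists t => //; rewrite -e scale1r scale0r addr0.
Qed.

Lemma linear_bound_continuous (V W : normedModType R) (L : {linear V -> W}) (c : R) :
  (forall h, `|L h| <= c * `|h|) -> continuous L.
Proof.
move=> Lc y; apply/cvgrPdist_le => e e0.
have c0 : 0 < `|c| + 1 by rewrite ltr_wpDl.
apply/nbhs_normP; exists (e / (`|c| + 1)); rewrite /= ?divr_gt0 // => z.
rewrite /ball_ /= -linearB ltr_pdivlMr // => /ltW yz.
apply: le_trans (Lc _) _; apply: le_trans yz; rewrite mulrC ler_wpM2l //.
by rewrite (le_trans (ler_norm c)) // lerDl.
Qed.

(** An expansion up to o(|h|) with a continuous linear candidate determines the differential, by
    [diff_unique]; the bound by [c] supplies the continuity. *)
Lemma is_diff_eps (V W : normedModType R) (F : V -> W) (L : {linear V -> W}) x (c : R) :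
  (forall h, `|L h| <= c * `|h|) ->
  (forall e : R, 0 < e -> exists2 r : R, 0 < r &
     forall h, `|h| < r -> `|F (x + h) - F x - L h| <= e * `|h|) ->
  is_diff x F L.
Proof.
move=> /linear_bound_continuous Lc FL.
have FLo : F \o shift x = cst (F x) + L +o_ 0 id.
  apply/eqaddoP => e e0; have [r r0 Hr] := FL e e0.
  rewrite near_simpl; apply/nbhs_normP; exists r => //= h.
  rewrite /ball_ /= sub0r normrN => /Hr.
  by rewrite !fctE /= opprD addrA (addrC h).
have dF := diff_unique Lc FLo.
by apply: DiffDef => //; apply/diff_locallyP; rewrite dF; split.
Qed.

(** Both endpoints move, unlike in Fréchet differentiability at [x]; this makes the later error
    bounds uniform over base points near [x]. *)
Definition strict_diff (V W : normedModType R) (F : V -> W) (x : V) (A : V -> W) :=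
  forall e : R, 0 < e -> exists2 r : R, 0 < r & forall u v,
    `|u - x| < r -> `|v - x| < r -> `|F u - F v - A (u - v)| <= e * `|u - v|.

Lemma diff_coord (V : normedModType R) (F : V -> vec) (x h : V) i :
  differentiable F x ->
  differentiable (fun z => F z i 0) x /\ 'd (fun z => F z i 0) x h = ('d F x h) i 0.
Proof.
move=> dF.
have cl : linear (fun M : vec => M i 0 : R^o) by move=> a u v; rewrite !mxE.
pose cL := GRing.isLinear.Build _ _ _ _ _ cl.
pose c : {linear vec -> R^o} := HB.pack (fun M : vec => M i 0 : R^o) cL.
have cc : continuous c by exact: coord_continuous.
have dc : differentiable c (F x) by exact: linear_differentiable.
have -> : (fun z => F z i 0) = c \o F by [].
split; first exact: differentiable_comp.
by rewrite diff_comp // diff_lin.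
Qed.

(** The mean value theorem is applied to each coordinate with its own intermediate point; continuity
    of [J] at [x] controls [J] at all of these points at once. *)
Lemma strict_diff_C1 (F : vec -> vec) (J : vec -> mat) (x : vec) (r : R) : 0 < r ->
  (forall z, `|z - x| < r ->
     differentiable F z /\ forall h, 'd F z h = J z *m h) ->
  {for x, continuous J} ->
  strict_diff F x (mulmx (J x)).
Proof.
move=> r0 dF Jc e e0.
(* Multiplying a vector by a matrix costs a factor [n] in the sup norm; [n + 1] is used so that one
   may divide by it also in dimension 0. *)
have N0 : 0 < n%:R + 1 :> R by rewrite ltr_wpDl.
have /cvgrPdist_lt/(_ (e / (n%:R + 1)) (divr_gt0 e0 N0)) := Jc.
move=> /nbhs_normP[s /= s0 Js].
exists (Num.min r s); first by rewrite lt_min r0.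
move=> u v; rewrite !lt_min => /andP[ur us] /andP[vr vs].
have {}us t : 0 <= t <= 1 -> `|v + t *: (u - v) - x| < s.
  by move=> t01; apply: ball_segment => //; rewrite (addrC v) subrK.
have {}ur t : 0 <= t <= 1 -> `|v + t *: (u - v) - x| < r.
  by move=> t01; apply: ball_segment => //; rewrite (addrC v) subrK.
apply: mx_norm_le => [|i j]; first by rewrite mulr_ge0 // ltW.
rewrite ord1.
have [|t t01] := @differentiable_line (fun z => F z i 0) v (u - v).
  by move=> t /ur /dF [dFt _]; apply: (diff_coord 0 i dFt).1.
have [dFt Jt] := dF _ (ur t t01).
rewrite (addrC v (u - v)) subrK (diff_coord _ i dFt).2 Jt => Fuv.
have -> : (F u - F v - J x *m (u - v)) i 0 =
    ((J (v + t *: (u - v)) - J x) *m (u - v)) i 0.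
  by rewrite mulmxBl [RHS]mxE -Fuv !mxE.
apply: le_trans (mx_norm_entry _ _ _) _; apply: le_trans (mulmx_norm _ _) _.
rewrite ler_wpM2r //.
have := Js (v + t *: (u - v)); rewrite /ball_ /= distrC => /(_ (us t t01)).
rewrite distrC ltr_pdivlMr// => /ltW; apply: le_trans.
by rewrite mulrC ler_wpM2l // lerDl.
Qed.

End Differentials.

(** * Gradients of envelopes, symmetry of Hessians, second-order expansions *)

Section Gradients.
Variables (R : realType) (n : nat).
Local Notation vec := 'cV[R]_n.
Local Notation mat := 'M[R]_n.

Let N := n%:R + 1 : R.
Let N_gt0 : 0 < N. Proof. by rewrite ltr_wpDl. Qed.

Let dotv_normN (u v : vec) : `|dotv u v| <= N * `|u| * `|v|.
Proof.
by apply: le_trans (dotv_norm _ _) _; rewrite !ler_wpM2r // lerDl.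
Qed.

Lemma is_grad_eps (F : vec -> R) (g x : vec) :
  (forall e : R, 0 < e -> exists2 r : R, 0 < r &
     forall h, `|h| < r -> `|F (x + h) - F x - dotv g h| <= e * `|h|) ->
  is_diff x F (dotv g).
Proof.
move=> Fg.
have ll : linear (dotv g : vec -> R^o) by move=> a u v; rewrite dotvDr dotvZr.
pose lL := GRing.isLinear.Build _ _ _ _ _ ll.
pose l : {linear vec -> R^o} := HB.pack (dotv g : vec -> R^o) lL.
by apply: (@is_diff_eps _ _ _ F l _ (N * `|g|)) => // h; exact: dotv_normN.
Qed.

Lemma is_diff_sqr_norm (w : vec) : is_diff w (fun z : vec => dotv z z) (dotv (2 *: w)).
Proof.
apply: is_grad_eps => e e0; exists (e / N); rewrite ?divr_gt0 // => h hr.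
have -> : dotv (w + h) (w + h) - dotv w w - dotv (2 *: w) h = dotv h h.
  by rewrite !dotvDl !dotvDr dotvZl (dotvC h w); ring.
apply: le_trans (dotv_normN _ _) _; rewrite ler_wpM2r //.
by move: hr; rewrite ltr_pdivlMr // mulrC => /ltW.
Qed.

(** Danskin's argument: testing the minimum at one point with the minimizer of the other bounds the
    increment of the envelope from both sides. *)
Lemma is_diff_envelope (q : vec -> R) (p : vec -> vec) (gam : R) (y : vec) :
  0 < gam ->
  (forall a b, q a + dotv (p a - a) (p a - a) / (2 * gam) <=
               q b + dotv (p b - a) (p b - a) / (2 * gam)) ->
  {for y, continuous p} ->
  is_diff y (fun a => q a + dotv (p a - a) (p a - a) / (2 * gam))
    (dotv (gam^-1 *: (y - p y))).
Proof.
move=> g0 qp pc; apply: is_grad_eps => e e0.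
have Ng : 0 < N / gam by rewrite divr_gt0.
have /cvgrPdist_lt/(_ (e / (N / gam)) (divr_gt0 e0 Ng))/nbhs_normP[s /= s0 ps] := pc.
exists (Num.min s (e / (N / gam))); first by rewrite lt_min s0 divr_gt0.
move=> h; rewrite lt_min => /andP[hs he].
pose E a := q a + dotv (p a - a) (p a - a) / (2 * gam).
rewrite -[X in `|X - _ - _|]/(E (y + h)) -[X in `|_ - X - _|]/(E y).
(* The minimizer [p y] competes at [y + h]; the excess over the linear term is
   [dotv h h / (2 * gam)]. *)
have up : E (y + h) - E y - dotv (gam^-1 *: (y - p y)) h <= N / gam * `|h| * `|h|.
  have -> : N / gam * `|h| * `|h| = N * `|h| * `|h| / gam by ring.
  apply: (@le_trans _ _ (dotv h h / (2 * gam))).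
    apply: le_trans (_ : q y + dotv (p y - (y + h)) (p y - (y + h)) / (2 * gam)
      - E y - dotv (gam^-1 *: (y - p y)) h <= _); first by rewrite !lerD2r; exact: qp.
    rewrite /E opprD addrA (dotvDl _ (- h)) !(dotvDr _ (- h)) !dotvNl !dotvNr dotvZl.
    rewrite (dotvC h) -(opprB (p y) y) dotvNl.
    by rewrite le_eqVlt; apply/orP; left; apply/eqP; field; rewrite gt_eqF.
  rewrite invfM mulrA ler_wpM2r ?invr_ge0 ?(ltW g0) //.
  apply: le_trans (_ : dotv h h <= _); first by have := dotv_ge0 h; lra.
  exact: le_trans (ler_norm _) (dotv_normN _ _).
(* Now [p (y + h)] competes at [y]; the error pairs [h] with [p y - p (y + h)], which continuity of
   [p] makes small. *)
have lo : - (N / gam * `|p y - p (y + h)| * `|h|)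
    <= E (y + h) - E y - dotv (gam^-1 *: (y - p y)) h.
  apply: (@le_trans _ _ (dotv h h / (2 * gam) + dotv (p y - p (y + h)) h / gam)).
    have := dotv_normN (p y - p (y + h)) h; rewrite ler_norml => /andP[+ _].
    rewrite -(@ler_pM2r _ gam^-1) ?invr_gt0 // => H.
    apply: le_trans (_ : dotv (p y - p (y + h)) h / gam <= _).
      by apply: le_trans H; rewrite le_eqVlt; apply/orP; left; apply/eqP; ring.
    by rewrite lerDr divr_ge0 ?dotv_ge0 // mulr_ge0 // ltW.
  have := qp y (y + h); rewrite -/(E y) => H.
  apply: le_trans (_ : E (y + h) - (q (y + h) + dotv (p (y + h) - y) (p (y + h) - y)
     / (2 * gam)) - dotv (gam^-1 *: (y - p y)) h <= _); last first.
    by rewrite lerD2r lerD2l lerN2.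
  rewrite /E opprD (addrA (p (y + h))) (dotvDl _ (- h)) !(dotvDr _ (- h)).
  rewrite !dotvNl !dotvNr dotvZl (dotvC h (p _ - y)) !dotvBl.
  by rewrite le_eqVlt; apply/orP; left; apply/eqP; field; rewrite gt_eqF.
have {}hs : `|p y - p (y + h)| <= e / (N / gam).
  by apply/ltW/ps; rewrite /ball_ /= opprD addrA subrr sub0r normrN.
rewrite ler_norml; apply/andP; split.
  apply: le_trans lo; rewrite lerN2 ler_wpM2r //.
  by move: hs; rewrite ler_pdivlMr // mulrC.
apply: le_trans up _; rewrite ler_wpM2r //.
by move: he; rewrite ltr_pdivlMr // mulrC => /ltW.
Qed.

Lemma dotv_sym_trmx (A : mat) :
  (forall s t, dotv (A *m s) t = dotv (A *m t) s) -> A^T = A.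
Proof.
move=> As; apply/matrixP => i j; rewrite mxE.
have dotvd (B : mat) k l :
    dotv (B *m (delta_mx l 0 : vec)) (delta_mx k 0 : vec) = B k l.
  rewrite -colE /dotv (bigD1 k) //= big1 => [|m mk]; rewrite !mxE ?eqxx ?mulr1 ?addr0 //.
  by rewrite (negbTE mk) mulr0.
by rewrite -!dotvd As.
Qed.

(* Schwarz: by the mean value theorem both bilinear forms approximate
   F (x + s + t) - F (x + s) - F (x + t) + F x up to o(|s| |t|), hence agree. *)
Lemma strict_diff_grad_sym (F : vec -> R) (G : vec -> vec) (A : mat) (x : vec) (r : R) :
  0 < r -> (forall z, `|z - x| < r -> is_diff z F (dotv (G z))) ->
  strict_diff G x (mulmx A) -> A^T = A.
Proof.
move=> r0 FG GA.
(* The mean value theorem in direction [s] is applied to the increment of [F] by [t]; strict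
   differentiability replaces the gradient difference by [A *m t]. *)
have key (e : R) : 0 < e -> exists2 rho : R, 0 < rho & forall s t : vec,
    `|s| < rho -> `|t| < rho ->
    `|F (x + s + t) - F (x + s) - F (x + t) + F x - dotv (A *m t) s|
      <= N * (e * `|t|) * `|s|.
  move=> /GA[r1 r10 H1].
  have m0 : 0 < Num.min r r1 by rewrite lt_min r0.
  exists (Num.min r r1 / 2).
    by rewrite divr_gt0 // lt_min r0.
  move=> s t sr tr.
  have sml (tau : R) : 0 <= tau <= 1 ->
      `|x + tau *: s - x| < Num.min r r1 /\ `|x + tau *: s + t - x| < Num.min r r1.
    move=> /andP[t0 t1]; have h : `|tau *: s| < Num.min r r1 / 2.
      by apply: le_lt_trans sr; rewrite normrZ ger0_norm // ler_piMl.
    rewrite (addrC x) addrK (addrAC _ x) addrK; split.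
      by apply: lt_le_trans h _; lra.
    apply: le_lt_trans (ler_normD _ _) _.
    by rewrite [ltRHS]splitr ltrD.
  have [tau tau01] : exists2 tau : R, 0 <= tau <= 1 &
      (F (x + 1 *: s + t) - F (x + 1 *: s)) - (F (x + 0 *: s + t) - F (x + 0 *: s))
      = dotv (G (x + tau *: s + t) - G (x + tau *: s)) s.
    apply: (@mvt01 _ (fun tau => F (x + tau *: s + t) - F (x + tau *: s))
      (fun tau => dotv (G (x + tau *: s + t) - G (x + tau *: s)) s)) => tau tau01.
    have [] := sml tau tau01; rewrite !lt_min => /andP[a1 _] /andP[a2 _].
    have D1 := FG _ a1; have D2 := FG _ a2.
    have E1 : is_derive tau 1 (fun z : R => F (x + z *: s + t)) (dotv (G (x + tau *: s + t)) s).
      under eq_fun do rewrite addrAC.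
      have := @is_derive_line _ _ F (x + t) s tau; rewrite (addrAC x t) diff_val.
      by apply; exact: ex_diff.
    have E2 : is_derive tau 1 (fun z : R => F (x + z *: s)) (dotv (G (x + tau *: s)) s).
      have := @is_derive_line _ _ F x s tau; rewrite diff_val.
      by apply; exact: ex_diff.
    by rewrite dotvBl; exact: is_deriveB.
  rewrite scale1r scale0r addr0 => e1.
  have -> : F (x + s + t) - F (x + s) - F (x + t) + F x - dotv (A *m t) s
     = dotv (G (x + tau *: s + t) - G (x + tau *: s) - A *m t) s.
    by rewrite [RHS]dotvBl -e1; ring.
  apply: le_trans (dotv_normN _ _) _; rewrite ler_wpM2r // ler_wpM2l ?(ltW N_gt0) //.
  have [] := sml tau tau01; rewrite !lt_min => /andP[_ a1] /andP[_ a2].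
  by have := H1 _ _ a2 a1; rewrite (addrAC _ t) subrr add0r.
apply: dotv_sym_trmx => s t; apply/eqP; rewrite -subr_eq0 -normr_eq0.
rewrite eq_le normr_ge0 andbT; apply/ler_addgt0Pr => e e0; rewrite add0r.
have c0 : 0 < 2 * N * (`|s| * `|t| + 1) by rewrite !mulr_gt0 // ltr_wpDl // mulr_ge0.
have [rho rho0 H] := key _ (divr_gt0 e0 c0).
(* Both bilinear forms scale by [a * a], so arbitrary [s] and [t] reduce to vectors shorter than
   [rho]. *)
pose a := rho / (`|s| + `|t| + 1).
have st0 : 0 < `|s| + `|t| + 1 by rewrite ltr_wpDl // addr_ge0.
have a0 : 0 < a by rewrite divr_gt0.
have as_ : `|a *: s| < rho.
  rewrite normrZ gtr0_norm // /a mulrAC ltr_pdivrMr // ltr_pM2l //.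
  by rewrite -addrA ltrDl ltr_wpDl.
have at_ : `|a *: t| < rho.
  rewrite normrZ gtr0_norm // /a mulrAC ltr_pdivrMr // ltr_pM2l //.
  by rewrite addrAC ltrDr ltr_wpDl.
have H1 := H _ _ as_ at_; have H2 := H _ _ at_ as_.
have aa0 : 0 < a * a by rewrite mulr_gt0.
rewrite -(ler_pM2l aa0).
have -> : a * a * `|dotv (A *m s) t - dotv (A *m t) s| =
   `|dotv (A *m (a *: s)) (a *: t) - dotv (A *m (a *: t)) (a *: s)|.
  rewrite -{1}(gtr0_norm aa0) -normrM -!scalemxAr !dotvZl !dotvZr; congr `|_|; ring.
(* The second difference of [F] is symmetric in its two increments and cancels, leaving only the two
   errors of [key]. *)
have -> : dotv (A *m (a *: s)) (a *: t) - dotv (A *m (a *: t)) (a *: s) =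
  (F (x + a *: s + a *: t) - F (x + a *: s) - F (x + a *: t) + F x
     - dotv (A *m (a *: t)) (a *: s)) -
  (F (x + a *: t + a *: s) - F (x + a *: t) - F (x + a *: s) + F x
     - dotv (A *m (a *: s)) (a *: t)).
  by rewrite (addrAC x (a *: t)); ring.
apply: le_trans (ler_normB _ _) _; apply: le_trans (lerD H1 H2) _.
rewrite !normrZ !gtr0_norm //.
set E := e / _; have Ee : E * (2 * N * (`|s| * `|t| + 1)) = e by rewrite divfK ?gt_eqF.
have E0 : 0 <= E by rewrite divr_ge0 ?ltW.
rewrite -Ee.
have -> : N * (E * (a * `|t|)) * (a * `|s|) + N * (E * (a * `|s|)) * (a * `|t|) =
  a * a * (E * (2 * N * (`|s| * `|t|))) by ring.
rewrite ler_wpM2l ?(ltW aa0) // ler_wpM2l // ler_wpM2l ?mulr_ge0 ?(ltW N_gt0) //.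
by rewrite lerDl.
Qed.

(** Along the segment, the derivative of [F] minus its quadratic model is the
    strict-differentiability error of [G] paired with [h]. The base point [u] varies while the
    Hessian stays frozen at [x]. *)
Lemma strict_diff_expansion (F : vec -> R) (G : vec -> vec) (B : mat) (x : vec) (r : R) :
  0 < r -> (forall z, `|z - x| < r -> is_diff z F (dotv (G z))) ->
  strict_diff G x (mulmx B) ->
  forall e : R, 0 < e -> exists2 s : R, 0 < s & forall u h,
    `|u - x| < s -> `|u + h - x| < s ->
    `|F (u + h) - F u - dotv (G u) h - 2^-1 * dotv (B *m h) h| <= e * `|h| ^+ 2.
Proof.
move=> r0 FG GB e e0; have [r1 r10 H1] := GB _ (divr_gt0 e0 N_gt0).
exists (Num.min r r1) => [|u h us vs]; first by rewrite lt_min r0.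
pose f (t : R) := F (u + t *: h) - t * dotv (G u) h - 2^-1 * t ^+ 2 * dotv (B *m h) h.
have [t t01] : exists2 t : R, 0 <= t <= 1 &
    f 1 - f 0 = dotv (G (u + t *: h) - G u - B *m (t *: h)) h.
  apply: mvt01 => t t01; have := ball_segment t01 us vs.
  rewrite lt_min => /andP[a1 _]; have D := FG _ a1.
  have D1 := @is_derive_line _ _ F u h t; rewrite diff_val in D1.
  have {}D1 := D1 (ex_diff).
  rewrite /f; apply: is_derive_eq.
  rewrite !dotvBl -scalemxAr dotvZl !scaler0 /=.
  by rewrite /GRing.scale /=; field.
have -> : f 1 - f 0 = F (u + h) - F u - dotv (G u) h - 2^-1 * dotv (B *m h) h.
  by rewrite /f scale1r scale0r addr0; ring.
move=> ->; apply: le_trans (dotv_normN _ _) _.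
have := ball_segment t01 us vs; move: us; rewrite !lt_min => /andP[_ a1] /andP[_ a2].
have := H1 _ _ a2 a1; rewrite (addrC u) addrK => H.
rewrite expr2 mulrA ler_wpM2r //.
rewrite mulrC -ler_pdivlMr //; apply: le_trans H _.
rewrite mulrAC ler_pM2r ?invr_gt0 // ler_pM2l // normrZ.
by case/andP: t01 => t0 t1; rewrite ger0_norm // ler_piMl.
Qed.

End Gradients.

(** * Least eigenvalue and Rayleigh quotient of a symmetric matrix *)

Section SymmetricMatrices.
Variables (R : realType) (n : nat).
Local Notation vec := 'cV[R]_n.
Implicit Types (B : 'M[R]_n) (v w : vec).

Lemma quadratic_ge0_linear0 (b c : R) : 0 <= c ->
  (forall t : R, 0 <= 2 * t * b + t ^+ 2 * c) -> b = 0.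
Proof.
move=> c0 H; apply/eqP; case: (eqVneq b 0) => // b0.
have c1 : 0 < c + 1 by rewrite ltr_wpDl.
(* The minimizer [- b / c] with [c] replaced by [c + 1], which also covers [c = 0]. *)
have := H (- b / (c + 1)).
have -> : 2 * (- b / (c + 1)) * b + (- b / (c + 1)) ^+ 2 * c
   = - (b ^+ 2 * (c + 2) / (c + 1) ^+ 2) by field; rewrite gt_eqF.
have b2 : 0 < b ^+ 2 by rewrite lt_neqAle sqr_ge0 andbT eq_sym sqrf_eq0.
by rewrite oppr_ge0 leNgt divr_gt0 ?exprn_gt0 // mulr_gt0 // ltr_wpDl.
Qed.

(** The quadratic form attains its minimum on the compact unit sphere, and the first-order condition
    there is the eigenvalue equation. The vector [v] makes the sphere nonempty. *)
Lemma symmetric_min_eigenvalue B v : B^T = B -> v != 0 ->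
  exists2 lam : R, eigenvalue B lam & forall w, lam * dotv w w <= dotv (B *m w) w.
Proof.
move=> Bs v0.
(* The sphere is made of row vectors, the form in which [bounded_closed_compact] and [eigenvalue]
   take them. *)
pose A := [set w : 'rV[R]_n | dotv w^T w^T = 1].
have normed (w : vec) : w != 0 -> A ((enorm w)^-1 *: w)^T.
  move=> w0; rewrite /A /= trmxK dotvZl dotvZr -enorm_sqr.
  have e0 : enorm w != 0 by rewrite -sqrf_eq0 enorm_sqr gt_eqF ?dotv_gt0.
  by rewrite mulrA -expr2 -exprMn mulVf ?expr1n.
have trc (w : 'rV[R]_n) : (fun t : 'rV[R]_n => t^T) @ w --> w^T.
  by apply: (@cvg_trmx R _ (nbhs w) 1 n (fun t => t) w); exact: cvg_id.
have fc : continuous (fun w : 'rV[R]_n => dotv (B *m w^T) w^T).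
  move=> w; apply: (cvg_dotv (nbhs_filter w) _ (trc w)).
  exact: (cvg_mulmx (A := fun=> B) (nbhs_filter w) (cvg_cst B) (trc w)).
have cA : compact A.
  apply: bounded_closed_compact.
    exists 1; split => // x x1 w /= Aw; apply: le_trans (ltW x1).
    rewrite -[leRHS](_ : enorm w^T = 1); last by rewrite /enorm Aw sqrtr1.
    apply: le_trans (norm_le_enorm _); apply: mx_norm_le => // i j.
    by rewrite ord1 -[w 0 j](mxE trmx_key (fun i j => w j i)) mx_norm_entry.
  apply: (@preimage_closed _ _ (fun w : 'rV[R]_n => dotv w^T w^T) [set x | x = 1]).
    by move=> w _; exact: (cvg_dotv (nbhs_filter w) (trc w) (trc w)).
  exact: closed_eq.
have A0 : A !=set0 by exists ((enorm v)^-1 *: v)^T; exact: normed.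
have [c cA' cmin] := compact_EVT_min A0 cA (continuous_subspaceT fc).
have {}cA' : dotv c^T c^T = 1 by move: cA'; rewrite inE.
set lam := dotv (B *m c^T) c^T in cmin.
have lamP w : lam * dotv w w <= dotv (B *m w) w.
  have [->|w0] := eqVneq w 0; first by rewrite mulmx0 dotv0r mulr0.
  have := cmin _ (mem_set (normed w w0)); rewrite trmxK -scalemxAr dotvZl dotvZr.
  by rewrite mulrA -expr2 exprVn enorm_sqr mulrC ler_pdivlMr ?dotv_gt0.
exists lam => //.
(* The residual is orthogonal to every [w]: [lamP] at [c^T + t *: w] is a nonnegative quadratic in
   [t] that vanishes at 0, so its linear coefficient is zero. *)
have Bc : B *m c^T - lam *: c^T = 0.
  apply: dotv_eq0; move: {2}(B *m c^T - _) => w.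
  apply: (@quadratic_ge0_linear0 _ (dotv (B *m w) w - lam * dotv w w)).
    by rewrite subr_ge0.
  move=> t; have := lamP (c^T + t *: w); rewrite -subr_ge0; congr (0 <= _).
  have BC : dotv (B *m w) c^T = dotv (B *m c^T) w by rewrite dotv_mulmx Bs dotvC.
  rewrite mulmxDr -scalemxAr dotvBl !(dotvDl, dotvDr) !(dotvZl, dotvZr) BC cA' (dotvC w).
  by rewrite -/lam; ring.
apply/eigenvalueP; exists c.
  by apply: trmx_inj; rewrite trmx_mul Bs linearZ /=; apply/eqP; rewrite -subr_eq0 Bc.
by apply/eqP => c0; move: cA'; rewrite c0 trmx0 dotv0l => /eqP; rewrite eq_sym oner_eq0.
Qed.

Lemma lam_min_le_rayleigh B v : B^T = B -> lam_min B * dotv v v <= dotv (B *m v) v.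
Proof.
move=> Bs; have [->|v0] := eqVneq v 0; first by rewrite mulmx0 dotv0r mulr0.
have [lam lamE lamP] := symmetric_min_eigenvalue Bs v0.
apply: le_trans (lamP v); rewrite ler_wpM2r ?dotv_ge0 //.
(* The infimum defining [lam_min] is meaningful only for a set bounded below; the least Rayleigh
   value [lam] is such a bound. *)
apply: ge_inf => //; exists lam => a /= /eigenvalueP[w wB w0].
have w1 : 0 < dotv w^T w^T.
  by apply: dotv_gt0; apply: contra w0 => /eqP w1; rewrite -[w]trmxK w1 trmx0.
rewrite -(ler_pM2r w1); apply: le_trans (lamP _) _.
by rewrite -[B]trmxK Bs -trmx_mul wB linearZ /= dotvZl.
Qed.

End SymmetricMatrices.

(** * Dynamics of the trust-region radius *)

Section TrustRegionRadius.
Variable R : realType.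

Lemma exists_expr_lt (z e : R) : 0 < z < 1 -> 0 < e -> exists j, z ^+ j < e.
Proof.
move=> /andP[z0 z1] e0.
have /cvg_expr/cvgrPdist_lt/(_ e e0)[j _ /(_ j (leqnn j))] : `|z| < 1.
  by rewrite gtr0_norm.
by rewrite sub0r normrN gtr0_norm ?exprn_gt0 //; exists j.
Qed.

(* A radius below c1 * rbar can only grow, hence exceeds it eventually; from then on an
   accepted step would decrease phi by a fixed amount, so every step is rejected and the
   radius decays geometrically. *)
Lemma trust_region_diverges (delta phi pred ared : nat -> R)
    (mu1 mu2 c1 c2 c3 c rbar : R) (K : nat) :
  0 < mu1 -> mu1 < mu2 -> 0 < c1 -> c1 < 1 -> 1 < c3 -> 0 < c -> 0 < rbar ->
  (forall k, 0 < delta k) ->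
  (forall k, delta k.+1 = if ared k / pred k < mu1 then c1 * delta k
     else if ared k / pred k < mu2 then c2 * delta k else c3 * delta k) ->
  (forall k, (K <= k)%N -> c * delta k ^+ 2 <= pred k) ->
  (forall k, mu1 <= ared k / pred k -> phi k - phi k.+1 = ared k) ->
  (forall k, (K <= k)%N -> delta k <= rbar -> mu2 <= ared k / pred k) ->
  cvgn phi -> False.
Proof.
move=> mu1_gt0 mu12 c1_gt0 c1_lt1 c3_gt1 c_gt0 rbar_gt0 delta_gt0 deltaE predP aredP good.
move=> /cvg_ex[l phil].
(* A rejected radius exceeds [rbar], so it stays above [lo] after shrinking by [c1]; [gap] is the
   decrease forced by an accepted step of radius at least [lo]. *)
set lo := c1 * rbar; have lo_gt0 : 0 < lo by rewrite mulr_gt0.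
set gap := mu1 * (c * lo ^+ 2); have gap_gt0 : 0 < gap by rewrite !mulr_gt0 // exprn_gt0.
have /cvgrPdist_lt/(_ (gap / 2) (divr_gt0 gap_gt0 (ltr0Sn _ 1)))[K1 _ phiK1] := phil.
pose K2 := maxn K K1.
have small k : (K2 <= k)%N -> phi k - phi k.+1 < gap.
  rewrite geq_max => /andP[_ K1k].
  have := phiK1 k K1k; have /= := phiK1 k.+1 (leqW K1k).
  by rewrite !ltr_norml; lra.
(* Acceptance would contradict [small], and by [good] a rejected radius cannot be at most [rbar]. *)
have rej k : (K2 <= k)%N -> lo <= delta k -> delta k.+1 = c1 * delta k /\ rbar < delta k.
  move=> K2k lok; have Kk : (K <= k)%N by move: K2k; rewrite geq_max => /andP[].
  have rhok : ared k / pred k < mu1.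
    rewrite ltNge; apply/negP => acc.
    have pk : 0 < pred k by apply: lt_le_trans (predP k Kk); rewrite mulr_gt0 // exprn_gt0.
    have := small k K2k; rewrite (aredP k acc) ltNge => /negP; apply.
    move: acc; rewrite ler_pdivlMr // => acc; apply: le_trans acc.
    rewrite /gap ler_pM2l //; apply: le_trans (predP k Kk).
    by rewrite ler_pM2l // lerXn2r // nnegrE ltW.
  rewrite deltaE rhok; split => //; rewrite ltNge; apply/negP => /(good k Kk).
  by rewrite leNgt (lt_trans rhok mu12).
(* Either a late radius reaches [lo], and the radii then decay like [c1 ^+ j] yet stay above [lo];
   or none does, and they grow like [c3 ^+ j] yet stay below [lo]. *)
have [[k [K2k lok]]|all_small] := pselect (exists k, (K2 <= k)%N /\ lo <= delta k).
  have geo j : lo <= delta (k + j)%N /\ delta (k + j)%N = c1 ^+ j * delta k.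
    elim: j => [|j [IH1 IH2]]; first by rewrite addn0 expr0 mul1r.
    have [E1 E2] := rej _ (leq_trans K2k (leq_addr j k)) IH1.
    by rewrite addnS E1 exprS -mulrA -IH2; split => //; rewrite ler_pM2l // ltW.
  have [||j jl] := @exists_expr_lt c1 (lo / delta k); rewrite ?c1_gt0 ?divr_gt0 //.
  have [+ e] := geo j; rewrite e leNgt => /negP; apply.
  by rewrite -ltr_pdivlMr.
have grow k : (K2 <= k)%N -> delta k < lo /\ delta k.+1 = c3 * delta k.
  move=> K2k; have lok : delta k < lo.
    by rewrite ltNge; apply/negP => lok; apply: all_small; exists k.
  split => //; have Kk : (K <= k)%N by move: K2k; rewrite geq_max => /andP[].
  have rk : delta k <= rbar.
    by apply: (le_trans (ltW lok)); rewrite /lo ler_piMl ?ltW.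
  have := good k Kk rk => r2.
  by rewrite deltaE ltNge (le_trans (ltW mu12) r2) /= ltNge r2.
have geo j : delta (K2 + j)%N = c3 ^+ j * delta K2.
  elim: j => [|j IH]; first by rewrite addn0 expr0 mul1r.
  by rewrite addnS (grow _ (leq_addr j K2)).2 IH exprS mulrA.
have c3_gt0 : 0 < c3 by apply: lt_trans c3_gt1.
have [||j jl] := @exists_expr_lt c3^-1 (delta K2 / lo).
- by rewrite invr_gt0 c3_gt0 invf_lt1.
- by rewrite divr_gt0.
have [+ _] := grow _ (leq_addr j K2); rewrite geo ltNge => /negP; apply.
move: jl; rewrite exprVn ltr_pdivlMr // mulrC ltr_pdivrMr ?exprn_gt0 // mulrC.
exact: ltW.
Qed.

End TrustRegionRadius.

(** * Jacobians and Clarke Jacobians of continuously differentiable maps *)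

Section Jacobians.
Variables (R : realType) (n : nat).
Local Notation vec := 'cV[R]_n.
Local Notation mat := 'M[R]_n.

Lemma diff_jacobian (F : vec -> vec) (z h : vec) : 'd F z h = Defs.jacobian F z *m h.
Proof.
rewrite {1}[h](_ : h = \sum_j h j 0 *: (delta_mx j 0 : vec)); last first.
  by rewrite {1}[h]matrix_sum_delta; apply: eq_bigr => i _; rewrite big_ord1.
rewrite linear_sum; apply/colP => i; rewrite summxE mxE; apply: eq_bigr => j _.
by rewrite linearZ !mxE mulrC.
Qed.

(** Continuity of the differential is asked direction by direction, which in finite dimension
    amounts to continuity of the Jacobian. *)
Definition C1_at (F : vec -> vec) (z : vec) :=
  differentiable F z /\
  forall h, {for z, continuous (fun y => ('d F y : vec -> vec) h)}.

Lemma jacobian_continuous (F : vec -> vec) (z : vec) :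
  C1_at F z -> {for z, continuous (Defs.jacobian F)}.
Proof.
move=> [_ dc]; have JE y i j : Defs.jacobian F y i j = ('d F y (delta_mx j 0 : vec)) i 0.
  by rewrite mxE.
have H i j : (fun y => Defs.jacobian F y i j) @ z --> Defs.jacobian F z i j.
  have -> : (fun y => Defs.jacobian F y i j) = (fun y => ('d F y (delta_mx j 0 : vec)) i 0).
    by apply/funext => y; exact: JE.
  rewrite JE; exact: (@cvg_mx_entry R _ (nbhs z) n 1 (fun y => 'd F y (delta_mx j 0 : vec)) _ i 0
    (nbhs_filter z) (dc (delta_mx j 0))).
exact: (cvg_mx (nbhs_filter z) H).
Qed.

(** Every limiting Jacobian equals the one at [z] by continuity, and the convex weights sum to 1.
    This identifies [P k] for late iterates. *)
Lemma clarke_jac_C1 (F : vec -> vec) (z : vec) (M : mat) :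
  C1_at F z -> clarke_jac F z M -> M = Defs.jacobian F z.
Proof.
move=> /jacobian_continuous Jc [m [w [A [_ [w1 [Abj ->]]]]]].
have AE i : A i = Defs.jacobian F z.
  have [u [uz [_ JA]]] := Abj i.
  exact: (cvg_unique _ JA (cvg_comp _ _ uz Jc)).
by under eq_bigr do rewrite AE; rewrite -scaler_suml w1 scale1r.
Qed.

Lemma C1_near (F : vec -> vec) (y : vec) (r : R) : 0 < r ->
  (forall z, eball y r z -> C1_at F z) ->
  exists2 s : R, 0 < s & forall z, `|z - y| < s -> C1_at F z.
Proof.
move=> r0 FC; have N0 : 0 < n%:R + 1 :> R by rewrite ltr_wpDl.
exists (r / (n%:R + 1)); first by rewrite divr_gt0.
move=> z; rewrite ltr_pdivlMr // => zr; apply: FC; apply: le_lt_trans zr.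
by apply: le_trans (enorm_le_norm _) _; rewrite mulrC ler_wpM2l // lerDl.
Qed.

Lemma strict_diff_C1_at (F : vec -> vec) (y : vec) (s : R) : 0 < s ->
  (forall z, `|z - y| < s -> C1_at F z) ->
  strict_diff F y (mulmx (Defs.jacobian F y)).
Proof.
move=> s0 FC; apply: (strict_diff_C1 s0) => [z zs|].
  by split; [exact: (FC z zs).1 | move=> h; exact: diff_jacobian].
by apply: jacobian_continuous; apply: FC; rewrite subrr normr0.
Qed.

End Jacobians.

(** * Calculus of strict derivatives *)

Section StrictDiffCalculus.
Variables (R : realType) (n : nat).
Local Notation vec := 'cV[R]_n.
Local Notation mat := 'M[R]_n.
Implicit Types (F G : vec -> vec) (x : vec) (A B : mat).

Let N := n%:R + 1 : R.
Let N_gt0 : 0 < N. Proof. by rewrite ltr_wpDl. Qed.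

Let mulmx_normN A (u : vec) : `|A *m u| <= N * `|A| * `|u|.
Proof.
by apply: le_trans (mulmx_norm _ _) _; rewrite !ler_wpM2r // lerDl.
Qed.

Lemma strict_diff_id x : strict_diff (fun z : vec => z) x (mulmx 1%:M).
Proof.
move=> e e0; exists 1 => // u v _ _.
by rewrite mul1mx subrr normr0 mulr_ge0 // ltW.
Qed.

Lemma strict_diffZ F x A (a : R) : strict_diff F x (mulmx A) ->
  strict_diff (fun z => a *: F z) x (mulmx (a *: A)).
Proof.
move=> FA e e0; have a0 : 0 < `|a| + 1 by rewrite ltr_wpDl.
have [r r0 H] := FA _ (divr_gt0 e0 a0); exists r => // u v ur vr.
rewrite -scalemxAl -!scalerBr normrZ; apply: le_trans (ler_wpM2l _ (H u v ur vr)) _ => //.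
by rewrite mulrA ler_wpM2r // mulrCA ler_piMr ?(ltW e0) // ler_pdivrMr // mul1r lerDl.
Qed.

Lemma strict_diffB F G x A B :
  strict_diff F x (mulmx A) -> strict_diff G x (mulmx B) ->
  strict_diff (fun z => F z - G z) x (mulmx (A - B)).
Proof.
move=> FA GB e e0; have e2 : 0 < e / 2 by rewrite divr_gt0.
have [r r0 HF] := FA _ e2; have [s s0 HG] := GB _ e2.
exists (Num.min r s); first by rewrite lt_min r0.
move=> u v; rewrite !lt_min => /andP[ur us] /andP[vr vs].
have -> : F u - G u - (F v - G v) - (A - B) *m (u - v) =
    (F u - F v - A *m (u - v)) - (G u - G v - B *m (u - v)).
  by rewrite mulmxBl; apply/matrixP => i j; rewrite !mxE; ring.
apply: le_trans (ler_normB _ _) _; apply: le_trans (lerD (HF _ _ ur vr) (HG _ _ us vs)) _.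
by rewrite -mulrDl -splitr.
Qed.

Lemma strict_diff_lipschitz F x A : strict_diff F x (mulmx A) ->
  exists2 r : R, 0 < r & forall u v, `|u - x| < r -> `|v - x| < r ->
    `|F u - F v| <= (N * `|A| + 1) * `|u - v|.
Proof.
move=> /(_ 1 ltr01)[r r0 H]; exists r => // u v ur vr.
rewrite -[F u - F v](subrK (A *m (u - v))) addrC.
apply: le_trans (ler_normD _ _) _; rewrite mulrDl; apply: lerD => //.
exact: H.
Qed.

Lemma strict_diff_comp F G x A B :
  strict_diff F x (mulmx A) -> strict_diff G (F x) (mulmx B) ->
  strict_diff (fun z => G (F z)) x (mulmx (B *m A)).
Proof.
move=> FA GB e e0; have [r r0 FL] := strict_diff_lipschitz FA.
set L := N * `|A| + 1 in FL; have L0 : 0 < L by rewrite ltr_wpDl // !mulr_ge0 // ltW.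
have B0 : 0 < N * `|B| + 1 by rewrite ltr_wpDl // !mulr_ge0 // ltW.
have e2 : 0 < e / 2 by rewrite divr_gt0.
(* The error of [G] is magnified by the Lipschitz constant [L] of [F], that of [F] by the norm of
   [B]; the tolerances compensate for both. *)
have [s s0 HG] := GB _ (divr_gt0 e2 L0); have [t t0 HF] := FA _ (divr_gt0 e2 B0).
exists (Num.min (Num.min r t) (s / L)); first by rewrite !lt_min r0 t0 divr_gt0.
have Fs u : `|u - x| < r -> `|u - x| < s / L -> `|F u - F x| < s.
  move=> ur us; apply: (@le_lt_trans _ _ (L * `|u - x|)).
    by apply: FL => //; rewrite subrr normr0.
  by rewrite mulrC -ltr_pdivlMr.
move=> u v; rewrite !lt_min => /andP[/andP[ur ut] us] /andP[/andP[vr vt] vs].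
have -> : G (F u) - G (F v) - B *m A *m (u - v) =
   (G (F u) - G (F v) - B *m (F u - F v)) + B *m (F u - F v - A *m (u - v)).
  by rewrite (mulmxBr B (F u - F v)) -mulmxA addrA subrK.
apply: le_trans (ler_normD _ _) _; rewrite [e]splitr mulrDl; apply: lerD.
  apply: le_trans (HG _ _ (Fs u ur us) (Fs v vr vs)) _.
  by rewrite -mulrA ler_pM2l // ler_pdivrMl // FL.
apply: le_trans (mulmx_normN _ _) _.
apply: (@le_trans _ _ ((N * `|B| + 1) * `|F u - F v - A *m (u - v)|)).
  by rewrite ler_wpM2r // lerDl.
rewrite -ler_pdivlMl //; apply: le_trans (HF _ _ ut vt) _.
by rewrite mulrA [_^-1 * _]mulrC.
Qed.

(* Only Lipschitz continuity of the matrix factor is needed, because the vector factor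
   vanishes at x. *)
Lemma strict_diff_mulmx (Q : vec -> mat) F x A (r K : R) : 0 < r ->
  (forall u v, `|u - x| < r -> `|v - x| < r -> `|Q u - Q v| <= K * `|u - v|) ->
  F x = 0 -> strict_diff F x (mulmx A) ->
  strict_diff (fun z => Q z *m F z) x (mulmx (Q x *m A)).
Proof.
move=> r0 QK Fx FA e e0; have [s s0 FL] := strict_diff_lipschitz FA.
set L := N * `|A| + 1 in FL; have L0 : 0 < L by rewrite ltr_wpDl // !mulr_ge0 // ltW.
set K' := `|K| + 1; have K0 : 0 < K' by rewrite ltr_wpDl.
have {}QK u v : `|u - x| < r -> `|v - x| < r -> `|Q u - Q v| <= K' * `|u - v|.
  move=> ur vr; apply: le_trans (QK u v ur vr) _; rewrite ler_wpM2r //.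
  by apply: le_trans (ler_norm _) _; rewrite lerDl.
set M := `|Q x| + K' * r; have M0 : 0 < M by rewrite ltr_wpDl ?mulr_gt0.
have e3 : 0 < e / 3 by rewrite divr_gt0.
have [t t0 HF] := FA _ (divr_gt0 e3 (mulr_gt0 N_gt0 M0)).
(* On this radius the two terms that are products of small factors cost at most [e / 3] each. *)
set rho := e / 3 / (N * K' * L); have rho0 : 0 < rho by rewrite divr_gt0 // !mulr_gt0.
exists (Num.min (Num.min r s) (Num.min t rho)); first by rewrite !lt_min r0 s0 t0.
move=> u v; rewrite !lt_min.
move=> /andP[/andP[ur us] /andP[ut uh]] /andP[/andP[vr vs] /andP[vt vh]].
(* Three terms: the variation of [Q] against [F u], small because [F x = 0]; the strict error of
   [F]; and the drift of [Q v] from [Q x]. *)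
have -> : Q u *m F u - Q v *m F v - Q x *m A *m (u - v) =
   (Q u - Q v) *m F u + (Q v *m (F u - F v - A *m (u - v))
     + (Q v - Q x) *m (A *m (u - v))).
  rewrite !mulmxBl !mulmxBr -!mulmxA.
  by apply/matrixP => i j; rewrite !mxE; ring.
have -> : e * `|u - v| = e / 3 * `|u - v| + (e / 3 * `|u - v| + e / 3 * `|u - v|).
  by field.
apply: le_trans (ler_normD _ _) _; apply: lerD; last first.
  apply: le_trans (ler_normD _ _) _; apply: lerD.
    apply: le_trans (mulmx_normN _ _) _.
    have Qv : `|Q v| <= M.
      rewrite -[Q v](subrK (Q x)) addrC; apply: le_trans (ler_normD _ _) _.
      rewrite lerD2l; apply: le_trans (QK v x vr _) _; first by rewrite subrr normr0.
      by rewrite ler_pM2l // ltW.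
    apply: (@le_trans _ _ (N * M * `|F u - F v - A *m (u - v)|)).
      by rewrite ler_wpM2r // ler_pM2l.
    rewrite -ler_pdivlMl ?mulr_gt0 //; apply: le_trans (HF _ _ ut vt) _.
    by rewrite mulrA [_^-1 * _]mulrC.
  apply: le_trans (mulmx_normN _ _) _.
  apply: (@le_trans _ _ (N * (K' * rho) * (L * `|u - v|))).
    apply: ler_pM => //; first by rewrite mulr_ge0 // ltW.
      rewrite ler_pM2l //; apply: le_trans (QK v x vr _) _; first by rewrite subrr normr0.
      by rewrite ler_pM2l // ltW.
    by apply: le_trans (mulmx_normN _ _) _; rewrite ler_wpM2r // lerDl.
  rewrite le_eqVlt; apply/orP; left; apply/eqP; rewrite /rho; field.
  by rewrite !gt_eqF.
apply: le_trans (mulmx_normN _ _) _.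
apply: (@le_trans _ _ (N * (K' * `|u - v|) * (L * rho))).
  apply: ler_pM => //; first by rewrite mulr_ge0 // ltW.
    by rewrite ler_pM2l // QK.
  have := FL u x us; rewrite subrr normr0 Fx subr0 => /(_ s0) H; apply: le_trans H _.
  by rewrite ler_pM2l // ltW.
rewrite le_eqVlt; apply/orP; left; apply/eqP; rewrite /rho; field.
by rewrite !gt_eqF.
Qed.

End StrictDiffCalculus.

(** * The forward-backward envelope as a Moreau envelope after a gradient step *)

Section ForwardBackwardEnvelope.
Variables (R : realType) (n : nat).
Local Notation vec := 'cV[R]_n.
Local Notation mat := 'M[R]_n.
Variables (f : vec -> R) (gradf : vec -> vec) (hessf : vec -> mat) (g : vec -> \bar R).
Variables (gam : R) (p : vec -> vec).
Hypothesis gam_gt0 : 0 < gam.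
Hypothesis g_proper : proper_fun g.
Hypothesis p_prox : forall x, is_prox g gam x (p x).

Let fstep x := x - gam *: gradf x.

Lemma prox_fin_num y : g (p y) \is a fin_num.
Proof.
have [gN [z gz]] := g_proper; rewrite fin_numE gN /=; apply/eqP => gy.
have := p_prox y z; rewrite gy addye ?ltNye // leye_eq => /eqP.
by rewrite -(fineK gz) -EFinD.
Qed.

(** The Moreau envelope of [g], read off at its minimizer; [fine] loses nothing, by
    [prox_fin_num]. *)
Definition moreau (y : vec) : R :=
  fine (g (p y)) + dotv (p y - y) (p y - y) / (2 * gam).

Lemma moreau_le y z : ((moreau y)%:E <= g z + (dotv (z - y) (z - y) / (2 * gam))%:E)%E.
Proof.
by have := p_prox y z; rewrite !enorm_sqr -{1}(fineK (prox_fin_num y)) -EFinD.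
Qed.

Lemma is_diff_moreau y : {for y, continuous p} ->
  is_diff y moreau (dotv (gam^-1 *: (y - p y))).
Proof.
move=> pc; apply: is_diff_envelope => // a b.
by have := moreau_le a (p b); rewrite -(fineK (prox_fin_num b)) -EFinD lee_fin.
Qed.

(** The proximal map is the identity minus [gam] times the gradient of the Moreau envelope; [A] is
    the Hessian of that envelope, symmetric by Schwarz. *)
Lemma prox_jacobian_sym y (r : R) : 0 < r -> (forall z, `|z - y| < r -> C1_at p z) ->
  (Defs.jacobian p y)^T = Defs.jacobian p y.
Proof.
move=> r0 pC; have pS := strict_diff_C1_at r0 pC.
pose A := gam^-1 *: (1%:M - Defs.jacobian p y).
have AS : A^T = A.
  apply: (@strict_diff_grad_sym _ _ moreau (fun z => gam^-1 *: (z - p z)) _ y r) => //.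
    move=> z /pC[dp _]; apply: is_diff_moreau; exact: differentiable_continuous.
  move=> e e0; have [s s0 H] := pS _ (mulr_gt0 gam_gt0 e0).
  exists s => // u v us vs; rewrite /A -scalemxAl mulmxBl mul1mx -!scalerBr normrZ.
  rewrite gtr0_norm ?invr_gt0 // ler_pdivrMl // mulrA.
  apply: le_trans (H u v us vs); rewrite le_eqVlt; apply/orP; left; apply/eqP.
  by rewrite -[LHS]normrN; congr `|_|; apply/colP => i; rewrite !mxE; ring.
have JE : Defs.jacobian p y = 1%:M - gam *: A.
  by rewrite scalerA mulfV ?gt_eqF // scale1r opprB addrC subrK.
by rewrite JE linearB /= trmx1 linearZ /= AS.
Qed.

(** Completing the square in [u] turns the linear and quadratic terms into a squared distance to
    [fstep x]. *)
Lemma fbeE x : fbe f gradf g gam x =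
  (f x - gam / 2 * dotv (gradf x) (gradf x) + moreau (fstep x))%:E.
Proof.
have sq u : f x + dotv (gradf x) (u - x) + enorm (u - x) ^+ 2 / (2 * gam) =
    f x - gam / 2 * dotv (gradf x) (gradf x) +
      dotv (u - fstep x) (u - fstep x) / (2 * gam).
  have -> : u - fstep x = (u - x) + gam *: gradf x by rewrite opprB addrA addrAC.
  rewrite enorm_sqr; move: (u - x) => a.
  rewrite dotvDl !dotvDr !dotvZl !dotvZr (dotvC a (gradf x)).
  by field; rewrite gt_eqF.
have split u : ((f x + dotv (gradf x) (u - x))%:E + g u
      + (enorm (u - x) ^+ 2 / (2 * gam))%:E)%E =
    ((f x - gam / 2 * dotv (gradf x) (gradf x))%:E +
     (g u + (dotv (u - fstep x) (u - fstep x) / (2 * gam))%:E))%E.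
  by rewrite addeAC -EFinD sq EFinD -addeA (addeC (_ / _)%:E).
apply/eqP; rewrite eq_le; apply/andP; split.
  apply: ereal_inf_lbound; exists (p (fstep x)) => //.
  by rewrite split -(fineK (prox_fin_num _)) -!EFinD.
apply: le_ereal_inf_tmp => _ [u _ <-]; rewrite split EFinD leeD2l //.
exact: moreau_le.
Qed.

Lemma fbeRE : fbeR f gradf g gam =
  (fun x => f x - gam / 2 * dotv (gradf x) (gradf x) + moreau (fstep x)).
Proof. by apply/funext => x; rewrite /fbeR fbeE. Qed.

(** Chain rule on [fbeRE]: splitting [fstep x - p (fstep x)] as [x - p (fstep x)] minus
    [gam *: gradf x] cancels all terms in [gradf x], and symmetry of [Qmat] moves it onto the
    residual. *)
Lemma is_diff_fbeR x :
  is_diff x f (dotv (gradf x)) -> is_diff x gradf (mulmx (hessf x)) ->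
  (hessf x)^T = hessf x -> {for fstep x, continuous p} ->
  is_diff x (fbeR f gradf g gam) (dotv (Qmat hessf gam x *m Rres gradf p gam x)).
Proof.
move=> df dgf Hs pc; rewrite fbeRE.
have dN := is_diff_comp dgf (is_diff_sqr_norm (gradf x)).
have dY : is_diff x fstep (id - gam *: mulmx (hessf x)).
  exact: (is_diffB (is_diff_id x) (is_diffZ gam dgf)).
have dM := is_diff_comp dY (is_diff_moreau pc).
have dT := is_diffD (is_diffB df (is_diffZ (gam / 2) dN)) dM.
apply: is_diff_eq dT _; apply/funext => h.
have QS : (Qmat hessf gam x)^T = Qmat hessf gam x.
  by rewrite linearB /= trmx1 linearZ /= Hs.
rewrite !fctE /= dotv_mulmx QS /Qmat /Rres /Tmap mulmxBl mul1mx -scalemxAl.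
rewrite /GRing.scale /= -/(fstep x) !dotvZl.
rewrite -[scalemx gam _]/(gam *: _).
have -> : fstep x - p (fstep x) = (x - p (fstep x)) - gam *: gradf x by rewrite addrAC.
move: (x - p (fstep x)) => a; set w := h - _.
rewrite (dotvBl a) dotvZl /w !(dotvBr h) !dotvZr.
by field; rewrite gt_eqF.
Qed.

(** The residual vanishes at the fixed point, so only its own derivative, [gam^-1] times the
    identity minus P Q, survives in the product rule. *)
Lemma strict_diff_fbe_grad (xs : vec) (r K s : R) :
  (forall x, is_diff x gradf (mulmx (hessf x))) -> continuous hessf ->
  0 < r -> (forall y z, `|y - xs| < r -> `|z - xs| < r ->
     `|hessf y - hessf z| <= K * `|y - z|) ->
  0 < s -> (forall z, `|z - fstep xs| < s -> C1_at p z) ->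
  xs = Tmap gradf p gam xs ->
  strict_diff (fun x => Qmat hessf gam x *m Rres gradf p gam x) xs
    (mulmx (Bmat hessf gam xs (Defs.jacobian p (fstep xs)))).
Proof.
move=> dgf hc r0 hK s0 pC xsE.
have Sg : strict_diff gradf xs (mulmx (hessf xs)).
  apply: (strict_diff_C1 ltr01 _ (hc xs)) => z _; have D := dgf z.
  by split; [exact: ex_diff | move=> h; rewrite diff_val].
have SY : strict_diff fstep xs (mulmx (Qmat hessf gam xs)).
  exact: strict_diffB (@strict_diff_id _ _ xs) (strict_diffZ gam Sg).
have Sp := strict_diff_comp SY (strict_diff_C1_at s0 pC).
have SR := strict_diffZ gam^-1 (strict_diffB (@strict_diff_id _ _ xs) Sp).
rewrite /Bmat scalemxAr.
apply: (strict_diff_mulmx (F := Rres gradf p gam) (K := gam * K) r0) => //.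
  move=> u v ur vr; rewrite /Qmat opprB addrC addrA subrK -scalerBr normrZ.
  rewrite gtr0_norm // -mulrA ler_pM2l // distrC; exact: hK.
by rewrite /Rres -xsE subrr scaler0.
Qed.

Lemma fbe_le x : (fbe f gradf g gam x <= fplusg f g x)%E.
Proof.
apply: ereal_inf_lbound; exists x => //.
by rewrite subrr dotv0r addr0 enorm_sqr dotv0l mul0r adde0.
Qed.

(** At a fixed point the minimizer in the envelope is [xs] itself. With [fbe_le], the envelope is a
    minorant touching the objective at [xs]. *)
Lemma fbe_fixpoint xs : xs = Tmap gradf p gam xs ->
  fplusg f g xs = (fbeR f gradf g gam xs)%:E.
Proof.
move=> xsE; have gx := prox_fin_num (fstep xs); rewrite -[p _]/(Tmap gradf p gam xs) -xsE in gx.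
rewrite /fplusg -(fineK gx) -EFinD fbeRE /moreau -[p (fstep xs)]/(Tmap gradf p gam xs) -xsE.
have -> : xs - fstep xs = gam *: gradf xs by rewrite opprB addrC subrK.
rewrite dotvZl dotvZr; congr _%:E.
by field; rewrite gt_eqF.
Qed.

End ForwardBackwardEnvelope.

(** * Second-order stationarity from a quadratic lower bound *)

Section SecondOrderBound.
Variables (R : realType) (n : nat).
Local Notation vec := 'cV[R]_n.

Lemma second_order_stationary_quadratic (phi : vec -> \bar R) (x : vec) :
  phi x \is a fin_num ->
  (forall e : R, 0 < e -> exists2 s : R, 0 < s & forall h, `|h| < s ->
     (phi x - (e * `|h| ^+ 2)%:E <= phi (x + h)%R)%E) ->
  second_order_stationary phi x.
Proof.
move=> phix low; split.
  (* Constant sequences suffice: 0 is already a regular subgradient at [x]. *)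
  split => //; exists (fun=> x), (fun=> 0); split; first exact: cvg_cst.
  split; first exact: cvg_cst.
  split; first exact: cvg_cst.
  move=> _; split => // e e0; have [s s0 H] := low 1 ltr01.
  apply/nbhs_normP; exists (Num.min s e); first by rewrite /= lt_min s0.
  move=> y; rewrite /ball_ /= distrC lt_min => /andP[ys ye].
  have := H _ ys; rewrite (addrC x) subrK; apply: le_trans.
  rewrite leeD2l // lee_fin dotv0l sub0r mul1r lerN2 expr2.
  by apply: ler_pM => //; [exact: ltW | exact: norm_le_enorm].
move=> d; apply/lee_addgt0Pr => e e0.
(* Directions within distance 1 of [d] have squared norm at most [c], so tolerance [e / (2 * c)]
   lowers the difference quotient by at most [e]. *)
set c := (`|d| + 1) ^+ 2.
have c0 : 0 < c by rewrite exprn_gt0 // ltr_wpDl.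
have [s s0 H] := low (e / (2 * c)) (divr_gt0 e0 (mulr_gt0 (ltr0Sn _ 1) c0)).
set r := Num.min 1 (s / (`|d| + 1)).
have d1 : 0 < `|d| + 1 by rewrite ltr_wpDl.
have r0 : 0 < r by rewrite lt_min ltr01 divr_gt0.
rewrite -leeBlDr // sub0e; apply: le_ereal_sup_tmp.
exists (ereal_inf [set z | exists (t : R) (w' : vec),
  [/\ 0 < t < r, eball d r w' & z = dq2 phi x 0 t w']]); first by exists r.
apply: le_ereal_inf_tmp => _ [t [w [/andP[t0 tr] dw ->]]].
have wd : `|w| < `|d| + 1.
  rewrite -[w](subrK d) addrC; apply: le_lt_trans (ler_normD _ _) _.
  rewrite ltrD2l; apply: le_lt_trans (norm_le_enorm _) _; apply: lt_le_trans dw _.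
  by rewrite ge_min lexx.
have tws : `|t *: w| < s.
  rewrite normrZ gtr0_norm //; apply: (@lt_trans _ _ (t * (`|d| + 1))).
    by rewrite ltr_pM2l.
  by rewrite -ltr_pdivlMr //; apply: lt_le_trans tr _; rewrite ge_min lexx orbT.
have := H _ tws; rewrite /dq2 dotv0l mulr0 sube0.
rewrite -[in X in X -> _](fineK phix) -[in X in _ -> X](fineK phix).
(* A value [+oo] makes the quotient [+oo]; a value [-oo] contradicts the lower bound. *)
case: (phi (x + t *: w)) => [a| |] //=; last first.
  by move=> _; rewrite addye // gt0_mulye ?leey ?lte_fin ?divr_gt0 ?exprn_gt0.
rewrite -!EFinD -!EFinM !lee_fin => aP.
have tt : 0 < t ^+ 2 by rewrite exprn_gt0.
rewrite mulrA ler_pdivlMr //.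
have : e / (2 * c) * `|t *: w| ^+ 2 <= e / 2 * t ^+ 2.
  rewrite normrZ exprMn gtr0_norm // mulrCA [leRHS]mulrC ler_pM2l //.
  have -> : e / (2 * c) * `|w| ^+ 2 = e / 2 * (`|w| ^+ 2 / c) by field; rewrite gt_eqF.
  rewrite ler_piMr ?divr_ge0 ?(ltW e0) // ler_pdivrMr // mul1r.
  by rewrite lerXn2r ?nnegrE ?normr_ge0 ?(ltW d1) ?(ltW wd).
by move=> {}H; lra.
Qed.

End SecondOrderBound.

(** * Limits of affine matrix expressions *)

Section MatrixLimits.
Variables (R : realType) (T : Type) (F : set_system T) (m p : nat).
Variables (M : T -> 'M[R]_(m, p)) (L : 'M[R]_(m, p)).

Lemma cvg_mxZ (a : R) : Filter F -> M @ F --> L -> (fun t => a *: M t) @ F --> a *: L.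
Proof. by move=> FF; apply: cvgZl_tmp. Qed.

Lemma cvg_onemB (C : 'M[R]_(m, p)) : Filter F -> M @ F --> L ->
  (fun t => C - M t) @ F --> C - L.
Proof. by move=> FF ML; apply: cvgB => //; exact: cvg_cst. Qed.

End MatrixLimits.

(** * The envelope near the critical point *)

Section LocalModel.
Variables (R : realType) (n : nat).
Local Notation vec := 'cV[R]_n.
Local Notation mat := 'M[R]_n.
Variables (f : vec -> R) (gradf : vec -> vec) (hessf : vec -> mat) (g : vec -> \bar R).
Variables (gam : R) (p : vec -> vec) (xs : vec) (r K s : R).
Hypothesis gam_gt0 : 0 < gam.
Hypothesis g_proper : proper_fun g.
Hypothesis p_prox : forall x, is_prox g gam x (p x).
Hypothesis f_grad : forall x, is_diff x f (dotv (gradf x)).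
Hypothesis f_hess : forall x, is_diff x gradf (mulmx (hessf x)).
Hypothesis hess_continuous : continuous hessf.
Hypothesis r_gt0 : 0 < r.
Hypothesis hess_lipschitz : forall y z, `|y - xs| < r -> `|z - xs| < r ->
  `|hessf y - hessf z| <= K * `|y - z|.
Hypothesis s_gt0 : 0 < s.
Hypothesis p_C1 : forall z, `|z - (xs - gam *: gradf xs)| < s -> C1_at p z.
Hypothesis xs_fix : xs = Tmap gradf p gam xs.

Let fstep x := x - gam *: gradf x.
Let Phi := fbeR f gradf g gam.
Let G x := Qmat hessf gam x *m Rres gradf p gam x.
Let B x := Bmat hessf gam x (Defs.jacobian p (fstep x)).

Lemma hess_sym x : (hessf x)^T = hessf x.
Proof.
apply: (@strict_diff_grad_sym _ _ f gradf _ x 1) => //.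
apply: (strict_diff_C1 ltr01 _ (hess_continuous (x := x))) => z _; have D := f_hess z.
by split; [exact: ex_diff | move=> h; rewrite diff_val].
Qed.

Lemma fstep_continuous : continuous fstep.
Proof.
move=> x; have D := f_hess x.
have dY : is_diff x fstep (id - gam *: mulmx (hessf x)).
  exact: (is_diffB (is_diff_id x) (is_diffZ gam D)).
exact/differentiable_continuous/ex_diff.
Qed.

(** Halving the radius leaves a whole ball around [fstep x] on which [p] is C^1, as symmetry of the
    Jacobian there requires. *)
Lemma prox_C1_near : exists2 t : R, 0 < t & forall x, `|x - xs| < t ->
  C1_at p (fstep x) /\ (Defs.jacobian p (fstep x))^T = Defs.jacobian p (fstep x).
Proof.
have s2 : 0 < s / 2 by rewrite divr_gt0.
have /cvgrPdist_lt/(_ _ s2)/nbhs_normP[t /= t0 H] := @fstep_continuous xs.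
exists t => // x xt; have {}H : `|fstep x - fstep xs| < s / 2.
  by rewrite distrC; apply: H; rewrite /ball_ /= distrC.
have near z : `|z - fstep x| < s / 2 -> C1_at p z.
  move=> zx; apply: p_C1; rewrite -/(fstep xs) -(subrK (fstep x) z) -addrA.
  by apply: le_lt_trans (ler_normD _ _) _; rewrite [ltRHS]splitr ltrD.
split; first by apply: near; rewrite subrr normr0.
exact: (prox_jacobian_sym gam_gt0 g_proper p_prox s2 near).
Qed.

Lemma fbe_grad_near : exists2 t : R, 0 < t & forall x, `|x - xs| < t ->
  is_diff x Phi (dotv (G x)).
Proof.
have [t t0 H] := prox_C1_near; exists t => // x /H [[dp _] _].
apply: (is_diff_fbeR gam_gt0 g_proper p_prox (f_grad x) (f_hess x) (hess_sym x)).
exact: differentiable_continuous.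
Qed.

(** Expanded, [B x] is a multiple of Q - Q P Q with Q and P symmetric. Symmetry at the iterates is
    what lets [lam_min] be compared with Rayleigh quotients. *)
Lemma fbe_hess_sym : exists2 t : R, 0 < t & forall x, `|x - xs| < t -> (B x)^T = B x.
Proof.
have [t t0 H] := prox_C1_near; exists t => // x /H [_ PS].
have QS : (Qmat hessf gam x)^T = Qmat hessf gam x.
  by rewrite linearB /= trmx1 linearZ /= hess_sym.
rewrite /B /Bmat linearZ /= trmx_mul linearB /= trmx1 trmx_mul QS PS.
move: (Qmat _ _ _) => Q.
by rewrite mulmxBl mulmxBr mul1mx mulmx1 mulmxA.
Qed.

Lemma fbe_hess_continuous : {for xs, continuous B}.
Proof.
have Qc : Qmat hessf gam x @[x --> xs] --> Qmat hessf gam xs.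
  exact: (cvg_onemB (nbhs_filter xs) (cvg_mxZ (nbhs_filter xs)
    (hess_continuous (x := xs)))).
have Pc : Defs.jacobian p (fstep x) @[x --> xs] --> Defs.jacobian p (fstep xs).
  have pc : {for fstep xs, continuous (Defs.jacobian p)}.
    by apply: jacobian_continuous; apply: p_C1; rewrite subrr normr0.
  exact: (cvg_comp _ _ (@fstep_continuous xs) pc).
have PQc := cvg_onemB (C := 1%:M) (nbhs_filter xs) (cvg_mulmx (nbhs_filter xs) Pc Qc).
exact: (cvg_mxZ (nbhs_filter xs) (cvg_mulmx (nbhs_filter xs) Qc PQc)).
Qed.

Lemma fbe_expansion (e : R) : 0 < e -> exists2 t : R, 0 < t & forall u h,
  `|u - xs| < t -> `|u + h - xs| < t ->
  `|Phi (u + h) - Phi u - dotv (G u) h - 2^-1 * dotv (B xs *m h) h| <= e * `|h| ^+ 2.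
Proof.
move=> e0; have [t t0 H] := fbe_grad_near.
apply: (strict_diff_expansion t0 H) => //.
exact: (strict_diff_fbe_grad gam_gt0 f_hess hess_continuous r_gt0 hess_lipschitz
  s_gt0 p_C1 xs_fix).
Qed.

(** The gradient of the envelope vanishes at [xs], so its expansion there bounds the touching
    objective below up to o(|h|^2). *)
Lemma second_order_stationary_psd :
  (forall v, 0 <= dotv (B xs *m v) v) -> second_order_stationary (fplusg f g) xs.
Proof.
move=> psd; have phixs := fbe_fixpoint f gam_gt0 g_proper p_prox xs_fix.
apply: second_order_stationary_quadratic; first by rewrite phixs.
move=> e e0; have [t t0 H] := fbe_expansion e0; exists t => // h ht.
apply: le_trans (fbe_le f gradf g gam _).
have := H xs h; rewrite subrr normr0 (addrC xs h) addrK => /(_ t0 ht).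
have -> : G xs = 0 by rewrite /G /Rres -xs_fix subrr scaler0 mulmx0.
rewrite dotv0l subr0 ler_norml => /andP[lo _]; have := psd h.
rewrite phixs (fbeE f gradf gam_gt0 g_proper p_prox).
have -> : f (h + xs) - gam / 2 * dotv (gradf (h + xs)) (gradf (h + xs)) +
  moreau g gam p (h + xs - gam *: gradf (h + xs)) = Phi (h + xs).
  by rewrite /Phi (fbeRE f gradf gam_gt0 g_proper p_prox).
by rewrite -EFinD lee_fin -/Phi => {}psd; lra.
Qed.

End LocalModel.

(** * Exclusion of negative curvature at the limit *)

Theorem theorem4p9 (R : realType) (n : nat)
    (f : 'cV[R]_n -> R) (gradf : 'cV[R]_n -> 'cV[R]_n) (hessf : 'cV[R]_n -> 'M[R]_n)
    (g : 'cV[R]_n -> \bar R) (prox : R -> 'cV[R]_n -> 'cV[R]_n) (Lf rho : R) :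
  (* f is C^{2+}: gradient gradf, Hessian hessf, Hessian continuous and locally Lipschitz *)
  (forall x, differentiable f x /\ ('d f x : 'cV[R]_n -> R) = (fun h => dotv (gradf x) h)) ->
  (forall x, differentiable gradf x /\
     ('d gradf x : 'cV[R]_n -> 'cV[R]_n) = (fun h => hessf x *m h)) ->
  continuous hessf ->
  (forall x, exists2 r : R, 0 < r & exists K : R, forall y z,
     eball x r y -> eball x r z -> `|hessf y - hessf z| <= K * enorm (y - z)) ->
  (* gradf is Lf-Lipschitz *)
  0 < Lf -> (forall x y, enorm (gradf x - gradf y) <= Lf * enorm (x - y)) ->
  (* g proper, lsc, rho-weakly convex *)
  proper_fun g -> lsc g -> 0 < rho -> weakly_convex rho g ->
  (* argmin (f + g) nonempty *)
  (exists xm, is_argmin (fplusg f g) xm) ->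
  (* prox gam = prox_{gam g} *)
  (forall gam, 0 < gam -> gam < rho^-1 -> forall x, is_prox g gam x (prox gam x)) ->
  (* for all sufficiently small stepsizes gam ... *)
  exists2 gbar : R, 0 < gbar &
  forall gam : R, 0 < gam -> gam < gbar -> gam < Lf^-1 -> gam < rho^-1 ->
  forall (x0 : 'cV[R]_n) (delta0 mu1 mu2 c1 c2 c3 : R)
    (x : nat -> 'cV[R]_n) (delta : nat -> R) (P : nat -> 'M[R]_n) (d : nat -> 'cV[R]_n)
    (xstar : 'cV[R]_n) (beta2 : R),
  (* bounded sublevel set *)
  (exists M : R, forall y, (fplusg f g y <= fplusg f g x0)%E -> enorm y <= M) ->
  (* NTRA parameters *)
  0 < delta0 -> 0 < mu1 -> mu1 < mu2 -> mu2 < 1 -> 0 < c1 -> c1 < c2 -> c2 < 1 -> 1 < c3 ->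
  (* NTRA iterates *)
  x 0%N = x0 -> delta 0%N = delta0 ->
  (forall k, clarke_jac (prox gam) (x k - gam *: gradf (x k)) (P k)) ->
  (forall k, ~ (Rres gradf (prox gam) gam (x k) = 0 /\
                0 <= lam_min (Bmat hessf gam (x k) (P k)))) ->
  (forall k, enorm (d k) <= delta k) ->
  (forall k,
     let mk := tr_model f gradf g gam (x k) (Bmat hessf gam (x k) (P k)) in
     let rhok := (fbeR f gradf g gam (x k) - fbeR f gradf g gam (x k + d k))
                 / (mk 0 - mk (d k)) in
     x k.+1 = (if rhok < mu1 then x k else x k + d k) /\
     delta k.+1 = (if rhok < mu1 then c1 * delta k
                   else if rhok < mu2 then c2 * delta k else c3 * delta k)) ->
  (* convergence to a critical point *)
  x @ \oo --> xstar ->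
  xstar = Tmap gradf (prox gam) gam xstar ->
  (* f is C^3 near xstar *)
  (exists2 r : R, 0 < r & forall y, eball xstar r y ->
     differentiable hessf y /\
     forall h, {for y, continuous (fun z => ('d hessf z : 'cV[R]_n -> 'M[R]_n) h)}) ->
  (* prox_{gam g} is C^1 near xstar - gam * gradf xstar *)
  (exists2 r : R, 0 < r & forall y, eball (xstar - gam *: gradf xstar) r y ->
     differentiable (prox gam) y /\
     forall h, {for y, continuous (fun z => ('d (prox gam) z : 'cV[R]_n -> 'cV[R]_n) h)}) ->
  (* curvature-sufficient decrease when B_k is indefinite *)
  0 < beta2 ->
  (forall k, lam_min (Bmat hessf gam (x k) (P k)) < 0 ->
     let mk := tr_model f gradf g gam (x k) (Bmat hessf gam (x k) (P k)) in
     beta2 * (- lam_min (Bmat hessf gam (x k) (P k))) * delta k ^+ 2 <= mk 0 - mk (d k)) ->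
  second_order_stationary (fplusg f g) xstar.
Proof.
move=> Hf Hg hc Hlip Lf0 _ gpr _ rho0 _ _ Hprox.
(* Any positive witness works, because [gam < rho^-1] already makes [prox gam] a proximal map of
   [g]. *)
exists 1 => // gam gam0 _ _ gamrho x0 delta0 mu1 mu2 c1 c2 c3 x delta P d xs beta2 _.
move=> delta00 mu10 mu12 mu21 c10 c12 c21 c31 _ deltaI HP _ Hd Hstep xcvg xsE _ HC1.
move=> beta20 Hcurv.
set p := prox gam in HP Hstep xsE HC1 Hcurv *.
have pprox := Hprox gam gam0 gamrho; rewrite -/p in pprox.
have dF z : is_diff z f (dotv (gradf z)) by have [] := Hf z; exact: DiffDef.
have dG z : is_diff z gradf (mulmx (hessf z)) by have [] := Hg z; exact: DiffDef.
have N0 : 0 < n%:R + 1 :> R by rewrite ltr_wpDl.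
have eN (u : 'cV[R]_n) : enorm u <= (n%:R + 1) * `|u|.
  by apply: le_trans (enorm_le_norm _) _; rewrite ler_wpM2r // lerDl.
have [s s0 pC] : exists2 s : R, 0 < s &
    forall z, `|z - (xs - gam *: gradf xs)| < s -> C1_at p z.
  by have [r0 r00 H0] := HC1; exact: (C1_near r00 H0).
have [r r0 [K hK]] : exists2 r : R, 0 < r & exists K : R, forall y z,
    `|y - xs| < r -> `|z - xs| < r -> `|hessf y - hessf z| <= K * `|y - z|.
  have [r r0 [K HK]] := Hlip xs.
  exists (r / (n%:R + 1)); first by rewrite divr_gt0.
  exists (`|K| * (n%:R + 1)) => y z; rewrite !ltr_pdivlMr // => yr zr.
  have inb u : `|u - xs| * (n%:R + 1) < r -> eball xs r u.
    by move=> ur; apply: le_lt_trans ur; rewrite mulrC.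
  apply: le_trans (HK y z (inb y yr) (inb z zr)) _.
  apply: (@le_trans _ _ (`|K| * enorm (y - z))).
    by rewrite ler_wpM2r ?sqrtr_ge0 // ler_norm.
  by rewrite -mulrA ler_wpM2l.
have half (a b : R) : `|b - a| < - (b / 2) -> a < b / 2 by rewrite ltr_norml; lra.
(* [bx] and [bs] are the curvature terms at the iterate and at the limit; the two errors [q]
   together use up at most the share [1 - m] of the predicted decrease [pr]. *)
have reduction (F1 F0 gd bx bs q m pr : R) : pr = - (gd + 2^-1 * bx) ->
    `|F1 - F0 - gd - 2^-1 * bs| <= q -> `|2^-1 * (bx - bs)| <= q ->
    2 * q <= (1 - m) * pr -> m * pr <= F0 - F1.
  by move=> ->; rewrite !ler_norml => /andP[_ e1] /andP[e2 e2']; lra.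
have psdP := second_order_stationary_psd gam0 gpr pprox dF dG hc r0 hK s0 pC xsE.
apply: psdP => v; rewrite leNgt; apply/negP => Bv.
have [t1 t10 H1] := fbe_grad_near gam0 gpr pprox dF dG hc s0 pC.
have [t2 t20 H2] := prox_C1_near gam0 gpr pprox dG s0 pC.
have [t3 t30 H3] := fbe_hess_sym gam0 gpr pprox dF dG hc s0 pC.
have Bc := fbe_hess_continuous dG hc s0 pC.
cbv beta in Bv, H1, H2, H3, Bc.
set Phi := fbeR f gradf g gam.
pose fstep z := z - gam *: gradf z.
pose B z := Bmat hessf gam z (Defs.jacobian p (fstep z)).
rewrite -/(fstep xs) -/(B xs) in Bv Bc.
have Bxc : (fun k => B (x k)) @ \oo --> B xs by exact: (cvg_comp _ _ xcvg Bc).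
have v0 : v != 0 by apply: contraTneq Bv => ->; rewrite mulmx0 dotv0l ltxx.
have vv := dotv_gt0 v0.
(* Half the size of the negative Rayleigh quotient of [B xs] at [v]; the other half is room for
   [B (x k)] to vary. *)
set eps := - (dotv (B xs *m v) v / 2 / dotv v v).
have eps0 : 0 < eps by rewrite oppr_gt0 !pmulr_llt0 ?invr_gt0.
(* Makes [2 * eta * delta k ^+ 2] equal to the share [1 - mu2] of the guaranteed predicted
   decrease. *)
set eta := (1 - mu2) * (beta2 * eps) / 2.
have be0 : 0 < beta2 * eps by rewrite mulr_gt0.
have eta0 : 0 < eta by rewrite divr_gt0 // mulr_gt0 // subr_gt0.
have [t4 t40 H4] := fbe_expansion gam0 gpr pprox dF dG hc r0 hK s0 pC xsE eta0.
cbv beta in H4; rewrite -/Phi -/(fstep xs) -/(B xs) in H4.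
(* Half of [t4] is kept for the step, so trial points with radius at most [t4 / 2] stay where the
   expansion holds. *)
set tmin := Num.min (Num.min t1 t2) (Num.min t3 (t4 / 2)).
have tmin0 : 0 < tmin by rewrite !lt_min t10 t20 t30 divr_gt0.
have /cvgrPdist_lt/(_ _ tmin0)[K1 _ xK1] := xcvg.
have Bvc : (fun k => dotv (B (x k) *m v) v) @ \oo --> dotv (B xs *m v) v.
  apply: (cvg_dotv _ (cvg_mulmx _ Bxc (cvg_cst v)) (cvg_cst v)); exact: eventually_filter.
have hv0 : 0 < - (dotv (B xs *m v) v / 2) by rewrite oppr_gt0 pmulr_llt0 ?invr_gt0.
have /cvgrPdist_lt/(_ _ hv0)[K2 _ xK2] := Bvc.
set N := n%:R + 1 : R in N0 eN.
(* Each of [mulmx_norm] and [dotv_norm] costs one factor [N]. *)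
have eN0 : 0 < eta / (N * N) by rewrite divr_gt0 // mulr_gt0.
have /cvgrPdist_lt/(_ _ eN0)[K3 _ xK3] := Bxc.
pose K0 := maxn K1 (maxn K2 K3).
have near k : (K0 <= k)%N -> [/\ `|x k - xs| < tmin,
   dotv (B (x k) *m v) v < dotv (B xs *m v) v / 2 & `|B (x k) - B xs| < eta / (N * N)].
  rewrite !geq_max => /and3P[k1 k2 k3]; split.
  - by rewrite distrC; exact: xK1.
  - by apply: half; exact: xK2.
  - by rewrite distrC; exact: xK3.
have PE k : (K0 <= k)%N -> P k = Defs.jacobian p (fstep (x k)).
  move=> /near[]; rewrite !lt_min => /andP[/andP[_ xt] _] _ _.
  exact: (clarke_jac_C1 (H2 _ xt).1 (HP k)).
pose mk k := tr_model f gradf g gam (x k) (Bmat hessf gam (x k) (P k)).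
pose ared k := Phi (x k) - Phi (x k + d k).
pose pred k := mk k 0 - mk k (d k).
have xE k : x k.+1 = if ared k / pred k < mu1 then x k else x k + d k.
  by have [] := Hstep k.
have deltaE k : delta k.+1 = if ared k / pred k < mu1 then c1 * delta k
     else if ared k / pred k < mu2 then c2 * delta k else c3 * delta k.
  by have [] := Hstep k.
have delta_gt0 k : 0 < delta k.
  elim: k => [|k IH]; first by rewrite deltaI.
  rewrite deltaE; case: ifP => _; first by rewrite mulr_gt0.
  case: ifP => _; rewrite mulr_gt0 //; first exact: lt_trans c12.
  exact: lt_trans c31.
(* The Rayleigh quotient of [B (x k)] at [v] pushes [lam_min] below [- eps], which activates the
   curvature decrease condition. *)
have predP k : (K0 <= k)%N -> beta2 * eps * delta k ^+ 2 <= pred k.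
  move=> K0k; have [xt Bk _] := near k K0k.
  have xt3 : `|x k - xs| < t3 by move: xt; rewrite !lt_min => /and3P[_ -> _].
  have lam : lam_min (B (x k)) <= - eps.
    rewrite -(ler_pM2r vv); apply: le_trans (lam_min_le_rayleigh v (H3 _ xt3)) _.
    by rewrite /eps opprK divfK ?gt_eqF // ltW.
  have lam0 : lam_min (Bmat hessf gam (x k) (P k)) < 0.
    by rewrite PE // (le_lt_trans lam) // oppr_lt0.
  apply: le_trans (Hcurv k lam0); rewrite PE //.
  by rewrite ler_wpM2r ?sqr_ge0 // ler_pM2l // lerNr.
apply: (@trust_region_diverges _ delta (Phi \o x) pred ared mu1 mu2 c1 c2 c3
  (beta2 * eps) (t4 / 2) K0) => //.
- exact: lt_trans c21.
- by rewrite divr_gt0.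
- by move=> k acc; rewrite /= xE ltNge acc.
- move=> k K0k dk; have [xt _ Bk] := near k K0k.
  have := predP k K0k => pk.
  have pk0 : 0 < pred k by apply: lt_le_trans pk; rewrite mulr_gt0 // exprn_gt0.
  move: xt; rewrite !lt_min => /andP[/andP[xt1 _] /andP[_ xt4]].
  have dn : `|d k| <= delta k by exact: le_trans (norm_le_enorm _) (Hd k).
  have predE : pred k = - (dotv (Qmat hessf gam (x k) *m Rres gradf p gam (x k)) (d k)
      + 2^-1 * dotv (B (x k) *m d k) (d k)).
    have D := H1 _ xt1.
    rewrite /pred /mk /tr_model diff_val PE // -/Phi -/(B _) mulmx0 !dotv0r.
    by ring.
  have := H4 (x k) (d k); rewrite -addrA (addrC (d k)) addrA.
  have xt4' : `|x k - xs| < t4.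
    by apply: lt_trans xt4 _; rewrite ltr_pdivrMr // ltr_pMr // ltr1n.
  have xt4'' : `|x k - xs + d k| < t4.
    apply: le_lt_trans (ler_normD _ _) _; rewrite [ltRHS]splitr.
    by rewrite ltr_leD // (le_trans dn).
  move=> /(_ xt4' xt4'') e1.
  (* The model carries the curvature at the iterate, the expansion that at the limit; this bounds
     the discrepancy. *)
  have e2 : `|2^-1 * dotv ((B (x k) - B xs) *m d k) (d k)| <= eta * `|d k| ^+ 2.
    rewrite normrM ger0_norm ?invr_ge0 //.
    apply: (@le_trans _ _ `|dotv ((B (x k) - B xs) *m d k) (d k)|).
      by rewrite ler_piMl // invf_le1 // ler1n.
    apply: le_trans (dotv_norm _ _) _; rewrite expr2 mulrA ler_wpM2r //.
    apply: (@le_trans _ _ (N * (N * `|B (x k) - B xs| * `|d k|))).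
      apply: ler_pM => //; first by rewrite lerDl.
      apply: le_trans (mulmx_norm _ _) _.
      by rewrite !ler_wpM2r // lerDl.
    rewrite !mulrA ler_wpM2r //.
    by move: (ltW Bk); rewrite ler_pdivlMr ?mulr_gt0 // mulrC.
  have d2 : `|d k| ^+ 2 <= delta k ^+ 2 by rewrite lerXn2r ?nnegrE // ltW.
  have e3 : 2 * eta * `|d k| ^+ 2 <= (1 - mu2) * pred k.
    apply: (@le_trans _ _ (2 * eta * delta k ^+ 2)).
      by rewrite ler_wpM2l // mulr_ge0 // ltW.
    have -> : 2 * eta * delta k ^+ 2 = (1 - mu2) * (beta2 * eps * delta k ^+ 2).
      by rewrite /eta; field.
    by rewrite ler_wpM2l // subr_ge0 ltW.
  rewrite ler_pdivlMr //.
  rewrite mulmxBl dotvBl in e2; rewrite -mulrA in e3.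
  by rewrite /ared; apply: reduction e3; [exact: predE | exact: e1 | exact: e2].
(* The envelope values converge because [Phi] is differentiable, hence continuous, at [xs]. *)
- have D := H1 xs; have Pc : {for xs, continuous Phi}.
    have {}D := D _; rewrite subrr normr0 in D; have {}D := D t10.
    exact/differentiable_continuous/ex_diff.
  exact: (cvgP (Phi xs) (cvg_comp _ _ xcvg Pc)).
Qed.
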